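(* Let $K\subseteq\mathbb{R}^n$ be a convex body, $s\in\mathbb{R}^n$, and $f_s(x)=e^{\langle s,x\rangle}$ for $x\in K$ and $f_s(x)=0$ otherwise. Let $T\subseteq\mathbb{R}^n$ be a convex body such that for some $\delta\ge1$, $$\frac{\sqrt n}{\delta}E_{f_s}\subseteq T\subseteq\delta\sqrt nE_{f_s}.$$ Then $$N(K,T)\le(12\delta)^n\cdot\frac43\cdot\frac{\sup_{x\in K}f_s(x)}{f_s(b(K))}\quad\text{and}\quad N(T,K)\le(12\delta^2)^n\cdot\mathrm{vol}(\sqrt nB_2^n)\cdot\frac43\cdot L_{f_s}^n.$$
   Context: For an integrable logconcave $f\ge0$ with $0<\int f<\infty$: $b(f)=\int xf(x)dx/\int f$, $\mathrm{cov}(f)=\int(x-b(f))(x-b(f))^tf(x)dx/\int f$, inertial ellipsoid $E_f=\{x:x^t\mathrm{cov}(f)^{-1}x\le1\}$ (centered at the origin), and isotropic constant $L_f=\big(\sup_xf(x)/\int f\big)^{1/n}\det(\mathrm{cov}(f))^{1/(2n)}$. $b(K)=\frac1{\mathrm{vol}(K)}\int_Kx\,dx$ is the centroid of $K$. $N(K,T)=\min\{|\Lambda|:K\subseteq\Lambda+T\}$. $B_2^n$ is the Euclidean unit ball. *)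

(* Defs.v *)
From HB Require Import structures.
From mathcomp Require Import all_boot all_order all_algebra finmap.
From mathcomp Require Import all_classical all_reals all_analysis.

Set Implicit Arguments.
Unset Strict Implicit.
Unset Printing Implicit Defensive.

Import Order.TTheory GRing.Theory Num.Theory.
Import numFieldNormedType.Exports.

Local Open Scope classical_set_scope.
Local Open Scope ring_scope.

(* R^n is 'rV[R]_n, with its library topology and vector space structure. Its
   sigma-algebra is generated by the coordinate functions, as the library does
   for n.-tuple T; this is the Borel sigma-algebra. *)

Definition rV_display : measure_display.
Proof. exact: default_measure_display. Qed.

Section rV_measurable.
Context {R : realType} {n : nat}.

Let coord (i : 'I_n) (x : 'rV[R]_n) : measurableTypeR R := x ord0 i.

Let rV_set0 : g_sigma_preimage coord set0.
Proof. exact: sigma_algebra0. Qed.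

Let rV_setC A : g_sigma_preimage coord A -> g_sigma_preimage coord (~` A).
Proof. exact: sigma_algebraC. Qed.

Let rV_bigcup (F : _^nat) : (forall i, g_sigma_preimage coord (F i)) ->
  g_sigma_preimage coord (\bigcup_i (F i)).
Proof. exact: sigma_algebra_bigcup. Qed.

HB.instance Definition _ := @isMeasurable.Build rV_display
  'rV[R]_n (g_sigma_preimage coord) rV_set0 rV_setC rV_bigcup.

Lemma measurable_coord (i : 'I_n) :
  measurable_fun [set: 'rV[R]_n] (fun x => x ord0 i : measurableTypeR R).
Proof.
move=> _ Y mY; rewrite setTI; apply: sub_sigma_algebra => /=.
rewrite -bigcup_seq/=; exists i => /=; first by rewrite mem_index_enum.
by exists Y => //; rewrite setTI.
Qed.

Lemma measurable_fun_rV d (T : measurableType d) (f : T -> 'rV[R]_n) :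
  (forall i, measurable_fun setT (fun t => f t ord0 i : measurableTypeR R)) ->
  measurable_fun setT f.
Proof.
move=> mf.
suff : measurable `<=` [set A : set 'rV[R]_n | measurable (f @^-1` A)].
  by move=> sub _ A mA; rewrite setTI; exact: sub.
apply: smallest_sub.
  split => /= [|A mA|F mF]; first by rewrite preimage_set0.
  - by rewrite setTD preimage_setC; exact: measurableC.
  - by rewrite preimage_bigcup; exact: bigcupT_measurable.
move=> A; rewrite -bigcup_seq/= => -[i _ [B mB <-]] /=.
by rewrite setTI; have := mf i measurableT B mB; rewrite setTI.
Qed.

End rV_measurable.

(* Cavalieri's principle: the measure of A in R^(n+1) is the integral of the
   n-dimensional measures of its slices {x | (t, x) \in A}. *)
Fixpoint lebesgue_rV {R : realType} (n : nat) : set 'rV[R]_n -> \bar R :=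
  match n return set 'rV[R]_n -> \bar R with
  | 0 => \d_(0 : 'rV[R]_0)
  | m.+1 => fun A => (\int[@lebesgue_measure R]_t
      lebesgue_rV [set x : 'rV[R]_m | A (row_mx (t%:M : 'M[R]_1) x)])%E
  end.

Section lebesgue_rV_step.
Context {R : realType} {n : nat}
  (mu : {sigma_finite_measure set 'rV[R]_n -> \bar R}).

Let cons_rV (p : measurableTypeR R * 'rV[R]_n) : 'rV[R]_n.+1 :=
  row_mx (p.1%:M : 'M[R]_1) p.2.

Let uncons_rV (x : 'rV[R]_n.+1) : measurableTypeR R * 'rV[R]_n :=
  (x ord0 ord0, rsubmx (x : 'rV[R]_(1 + n))).

Let cons_rVK : cancel cons_rV uncons_rV.
Proof.
move=> [t x]; rewrite /uncons_rV /cons_rV /= row_mxKr; congr (_, _).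
have -> : ord0 = lshift n (ord0 : 'I_1) :> 'I_(1 + n) by apply: val_inj.
by rewrite [LHS](@row_mxEl _ 1 1 n) mxE eqxx mulr1n.
Qed.

Let measurable_cons_rV : measurable_fun setT cons_rV.
Proof.
apply: measurable_fun_rV => i; case: (@split_ordP 1 n i) => j ->.
- rewrite (_ : (fun _ => _) = fst)//; apply/funext => p.
  by rewrite /cons_rV [LHS](@row_mxEl _ 1 1 n) (ord1 j) mxE eqxx mulr1n.
- rewrite (_ : (fun _ => _) = (fun x : 'rV[R]_n => x ord0 j) \o snd).
    by apply: measurableT_comp => //; exact: measurable_coord.
  by apply/funext => p; rewrite /cons_rV [LHS](@row_mxEr _ 1 1 n).
Qed.

Let measurable_uncons_rV : measurable_fun setT uncons_rV.
Proof.
apply: measurable_fun_pair; first exact: measurable_coord.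
apply: measurable_fun_rV => i.
rewrite (_ : (fun _ => _) = (fun x : 'rV[R]_n.+1 => x ord0 (rshift 1 i))).
  exact: measurable_coord.
by apply/funext => x; rewrite mxE.
Qed.

Definition lebesgue_rV_step (A : set 'rV[R]_n.+1) : \bar R :=
  (\int[@lebesgue_measure R]_t
    mu [set x : 'rV[R]_n | A (row_mx (t%:M : 'M[R]_1) x)])%E.

Let stepE A :
  lebesgue_rV_step A = ((@lebesgue_measure R \x mu) (cons_rV @^-1` A))%E.
Proof.
apply: eq_integral => t _ /=; congr (mu _); apply/seteqP; split => x /=.
- by move=> Ax; rewrite /xsection/= inE.
- by rewrite /xsection/= inE.
Qed.

Let step0 : lebesgue_rV_step set0 = 0%E.
Proof. by rewrite stepE preimage_set0 measure0. Qed.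

Let step_ge0 A : (0 <= lebesgue_rV_step A)%E.
Proof. by apply: integral_ge0 => t _; exact: measure_ge0. Qed.

Let step_sigma_additive : semi_sigma_additive lebesgue_rV_step.
Proof.
move=> F mF tF mUF; rewrite stepE preimage_bigcup.
rewrite (_ : (fun _ => _) = fun k => \sum_(0 <= i < k)
    (@lebesgue_measure R \x mu)%E (cons_rV @^-1` F i))%E; last first.
  by apply/funext => k; apply: eq_bigr => i _; rewrite stepE.
have mcF i : measurable (cons_rV @^-1` F i).
  by rewrite -[_ @^-1` _]setTI; exact: measurable_cons_rV.
apply: measure_semi_sigma_additive => //; last exact: bigcupT_measurable.
apply/trivIsetP => i j _ _ ij; rewrite -preimage_setI.
by move/trivIsetP : tF => /(_ i j Logic.I Logic.I ij) ->; rewrite preimage_set0.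
Qed.

HB.instance Definition _ := isMeasure.Build _ _ _ lebesgue_rV_step
  step0 step_ge0 step_sigma_additive.

Let step_sigma_finite : sigma_finite setT lebesgue_rV_step.
Proof.
have /sigma_finiteP[F [FT ndF Foo]] := sigma_finiteT (@lebesgue_measure R).
have /sigma_finiteP[G [GT ndG Goo]] := sigma_finiteT mu.
exists (fun k => uncons_rV @^-1` (F k `*` G k)).
  rewrite -preimage_bigcup (_ : \bigcup_k _ = setT) ?preimage_setT//.
  apply/seteqP; split => // -[t x] _.
  have [i _ Fit] : (\bigcup_i F i) t by rewrite -FT.
  have [j _ Gjx] : (\bigcup_i G i) x by rewrite -GT.
  exists (maxn i j) => //; split => /=.
  - by move: t Fit; exact/subsetPset/ndF/leq_maxl.
  - by move: x Gjx; exact/subsetPset/ndG/leq_maxr.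
move=> k; have [mF Fk] := Foo k; have [mG Gk] := Goo k; split.
  rewrite -[_ @^-1` _]setTI.
  by apply: measurable_uncons_rV => //; exact: measurableX.
rewrite stepE -comp_preimage (_ : uncons_rV \o cons_rV = id); last first.
  by apply/funext => p /=; exact: cons_rVK.
by rewrite preimage_id product_measure1E// lte_mul_pinfty// ge0_fin_numE.
Qed.

HB.instance Definition _ := Measure_isSigmaFinite.Build _ _ _
  lebesgue_rV_step step_sigma_finite.

End lebesgue_rV_step.

Section lebesgue_rV_measure.
Context {R : realType}.

Let lebesgue_rV_ex n :
  exists mu : {sigma_finite_measure set 'rV[R]_n -> \bar R},
    (mu : set _ -> _) = @lebesgue_rV R n.
Proof.
elim: n => [|n [mu muE]]; first by exists \d_(0 : 'rV[R]_0).
by exists (lebesgue_rV_step mu); rewrite /= -muE.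
Qed.

Variable n : nat.

Let lebesgue_rV0 : @lebesgue_rV R n set0 = 0%E.
Proof. by have [mu <-] := lebesgue_rV_ex n; exact: measure0. Qed.

Let lebesgue_rV_ge0 A : (0 <= @lebesgue_rV R n A)%E.
Proof. by have [mu <-] := lebesgue_rV_ex n; exact: measure_ge0. Qed.

Let lebesgue_rV_sigma_additive : semi_sigma_additive (@lebesgue_rV R n).
Proof.
by have [mu <-] := lebesgue_rV_ex n; exact: measure_semi_sigma_additive.
Qed.

HB.instance Definition _ := isMeasure.Build _ _ _ (@lebesgue_rV R n)
  lebesgue_rV0 lebesgue_rV_ge0 lebesgue_rV_sigma_additive.

Let lebesgue_rV_sigma_finite : sigma_finite setT (@lebesgue_rV R n).
Proof. by have [mu <-] := lebesgue_rV_ex n; exact: sigma_finiteT. Qed.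

HB.instance Definition _ := Measure_isSigmaFinite.Build _ _ _
  (@lebesgue_rV R n) lebesgue_rV_sigma_finite.

End lebesgue_rV_measure.

Section convex_geometry.
Context {R : realType} {n : nat}.
Implicit Types (x y : 'rV[R]_n) (f : 'rV[R]_n -> R) (A K T : set 'rV[R]_n).

Definition convex_body K :=
  [/\ @convex_set R 'rV[R]_n K, compact K & K° !=set0].

Definition dot x y : R := (x *m y^T) ord0 ord0.

Definition eucl_ball : set 'rV[R]_n := [set x | Num.sqrt (dot x x) <= 1].

Definition scale_set (r : R) A : set 'rV[R]_n := [set r *: x | x in A].

Definition vol A : R := fine (lebesgue_rV A).

Definition integral_rV f : R := \int[@lebesgue_rV R n]_x f x.

Definition centroid K : 'rV[R]_n :=
  \row_i ((vol K)^-1 * \int[@lebesgue_rV R n]_(x in K) x ord0 i).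

(* The functionals below are meant for logconcave integrable f >= 0 with
   positive integral; then every integral in them is finite, f is bounded and
   covar f is invertible, so that sup and invmx have their usual meaning. *)

Definition barycenter f : 'rV[R]_n :=
  \row_i (integral_rV (fun x => x ord0 i * f x) / integral_rV f).

Definition covar f : 'M[R]_n :=
  \matrix_(i, j)
    (integral_rV (fun x => ((x - barycenter f)^T *m (x - barycenter f)) i j
                           * f x)
     / integral_rV f).

Definition inertia_ellipsoid f : set 'rV[R]_n :=
  [set x | (x *m invmx (covar f) *m x^T) ord0 ord0 <= 1].

Definition isotropic_constant f : R :=
  (sup (range f) / integral_rV f) `^ (n%:R^-1)
  * (\det (covar f)) `^ ((2 * n)%:R^-1).

(* Cardinals being integers, the infimum is a minimum, unless no finite set of
   translates of T covers K, in which case the value is +oo. *)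
Definition covering_number K T : \bar R :=
  ereal_inf [set (#|` L|%:R)%:E | L in
    [set L : {fset 'rV[R]_n} | K `<=` [set l + t | l in [set` L] & t in T]]].

Definition exp_on K (s : 'rV[R]_n) (x : 'rV[R]_n) : R :=
  if x \in K then expR (dot s x) else 0.

End convex_geometry.

(* Main.v *)
(** Write [q] for the quadratic form of the inverse covariance of [f_s], [D] for
    the ellipsoid [q <= n] and [b] for the barycenter of [f_s].  The mean of
    [q (x - b)] is [n], so by Chebyshev the part [K0] of [K] in [b + 2 D] carries
    at least 3/4 of the mass, whence [3/4 * int f_s <= sup f_s * vol K0]; Jensen's
    inequality bounds the mass below by [vol K * f_s (b(K))].

    A maximal packing by translates of a set [S] gives a covering by translates
    of [S - S].  With [S = K0 / (4 delta)], [S - S] lies in [D / delta], hence in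
    [T], while [K + S] lies in a dilate of [K]: this bounds [N(K, T)].  For
    [N(T, K)], averaging [vol (K0 `&` (2 x - K0))] over [x] provides a center of
    [K0] around which the symmetric part of [K0] is large; packing halves of it in
    [2 delta D] bounds [N(T, K)], and the volume of [D] is computed from a
    Cholesky factorization of the covariance. *)
Require Import Defs.
From mathcomp Require Import all_boot all_order all_algebra finmap.
From mathcomp Require Import all_classical all_reals all_analysis.
From mathcomp Require Import measurable_realfun.
From mathcomp Require Import ring lra.

Set Implicit Arguments.
Unset Strict Implicit.
Unset Printing Implicit Defensive.

Import Order.TTheory GRing.Theory Num.Theory.
Import numFieldNormedType.Exports.

Local Open Scope classical_set_scope.
Local Open Scope ring_scope.

(** * Affine change of variables on the real line *)

(** The pushforward of Lebesgue measure by [t |-> a * t + c], multiplied by [a], gives every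
    half-open interval its length. By uniqueness it is Lebesgue measure, and the formula is
    integration against a pushforward. *)
Lemma integral_affine_line {R : realType} (f : R -> \bar R) (a c : R) :
  0 < a -> measurable_fun [set: R] f -> (forall t, (0 <= f t)%E) ->
  (a%:E * \int[@lebesgue_measure R]_t f (a * t + c)%R
    = \int[@lebesgue_measure R]_t f t)%E.
Proof.
move=> a0 mf f0.
pose phi := (fun t => a * t + c) : measurableTypeR R -> measurableTypeR R.
have mphi : measurable_fun setT phi.
  by apply: measurable_funD => //; exact: measurable_funM.
have a_nng : 0 <= a := ltW a0.
pose pf : {measure set (measurableTypeR R) -> \bar R} :=
  measure_function_pushforward__canonical__measure_function_Measure
    (@lebesgue_measure R) mphi.
pose nu := mscale (NngNum a_nng) pf.
have nuE A : measurable A -> @lebesgue_measure R A = nu A.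
  apply: lebesgue_measure_unique => _ [[u v] /= _ <-].
  rewrite /nu /mscale/= /pf/= /pushforward.
  have -> : phi @^-1` `]u, v] = `](u - c) / a, (v - c) / a]%classic.
    apply/seteqP; split=> t /=; rewrite /phi/= !in_itv/=.
    + by rewrite ltr_pdivrMr// ler_pdivlMr// ltrBlDr lerBrDr ![t * a]mulrC.
    + by rewrite ltr_pdivrMr// ler_pdivlMr// ltrBlDr lerBrDr ![t * a]mulrC.
  rewrite !lebesgue_measure_itv/= !lte_fin ltr_pM2r ?invr_gt0// ltrD2r.
  case: ifP => _; last by rewrite mule0.
  rewrite -!EFinD -EFinM; congr (_%:E); field; exact: lt0r_neq0.
rewrite [RHS](eq_measure_integral nu); last by move=> A mA _; exact: nuE.
rewrite /nu ge0_integral_mscale//=; congr (_ * _)%E.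
by rewrite ge0_integral_pushforward// preimage_setT.
Qed.

(** * Affine changes of variables in dimension [n], by slicing *)

Section affine_images.
Context {R : realType}.

Lemma lebesgue_rVS n (A : set 'rV[R]_n.+1) :
  lebesgue_rV A = (\int[@lebesgue_measure R]_t
    lebesgue_rV [set x : 'rV[R]_n | A (row_mx (t%:M : 'M[R]_1) x)])%E.
Proof. by []. Qed.

Lemma measurable_row_mx n :
  measurable_fun setT (fun p : measurableTypeR R * 'rV[R]_n =>
    row_mx (p.1%:M : 'M[R]_1) p.2 : 'rV[R]_n.+1).
Proof.
apply: measurable_fun_rV => i; case: (@split_ordP 1 n i) => j ->.
- rewrite (_ : (fun _ => _) = fst)//; apply/funext => p.
  by rewrite [LHS](@row_mxEl _ 1 1 n) (ord1 j) mxE eqxx mulr1n.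
- rewrite (_ : (fun _ => _) = (fun x : 'rV[R]_n => x ord0 j) \o snd).
    by apply: measurableT_comp => //; exact: measurable_coord.
  by apply/funext => p; rewrite [LHS](@row_mxEr _ 1 1 n).
Qed.

Lemma measurable_slice_volume n (A : set 'rV[R]_n.+1) : measurable A ->
  measurable_fun setT (fun t : measurableTypeR R =>
    lebesgue_rV [set x : 'rV[R]_n | A (row_mx (t%:M : 'M[R]_1) x)]).
Proof.
move=> mA.
have := measurable_row_mx measurableT mA; rewrite setTI.
move=> /(measurable_fun_xsection (@lebesgue_rV R n)).
congr measurable_fun; apply/funext => t /=; congr lebesgue_rV.
by apply/seteqP; split=> x; rewrite /xsection/= inE.
Qed.

Lemma measurable_affine m n (M : 'M[R]_(m, n)) (c : 'rV[R]_n) :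
  measurable_fun setT (fun x : 'rV[R]_m => x *m M + c).
Proof.
apply: measurable_fun_rV => i.
rewrite (_ : (fun _ => _) =
    (fun x : 'rV[R]_m => \sum_k x ord0 k * M k i + c ord0 i)).
  apply: measurable_funD => //; apply: measurable_sum => k.
  by apply: measurable_funM => //; exact: measurable_coord.
by apply/funext => x; rewrite !mxE.
Qed.

(** The change of variables formula for [x |-> x *m M + c]. It is a predicate on [M] so that it can
    be built up along block triangular matrices, which suffices in view of the Cholesky
    factorization. All shifts [c] are included because slicing produces a shift that depends on the
    slice. *)
Definition scales_volume n (M : 'M[R]_n) :=
  0 < \det M /\ forall c (A : set 'rV[R]_n), measurable A ->
    ((\det M)%:E * lebesgue_rV [set x | A (x *m M + c)%R] = lebesgue_rV A)%E.

(** The slice at [t] of the preimage of [A] is the preimage, under [M] with shift [t *: v + c2], of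
    the slice of [A] at [a * t + c1]. The property of [M] contributes [\det M] on each slice, and
    the substitution on the line contributes [a]. *)
Lemma scales_volume_block n (a : R) (v : 'rV[R]_n) (M : 'M[R]_n) :
  0 < a -> scales_volume M ->
  scales_volume (block_mx (a%:M : 'M[R]_1) v 0 M : 'M[R]_n.+1).
Proof.
move=> a0 [M0 volM]; rewrite /scales_volume.
have -> : \det (block_mx (a%:M : 'M[R]_1) v 0 M : 'M[R]_n.+1) = a * \det M.
  by rewrite (@det_ublock _ 1 n) det_scalar1.
split; first exact: mulr_gt0.
move=> c A mA.
pose c1 := c ord0 ord0; pose c2 : 'rV[R]_n := rsubmx (c : 'rV[R]_(1 + n)).
have cE : c = row_mx (c1%:M : 'M[R]_1) c2 :> 'rV[R]_(1 + n).
  rewrite -[LHS](@hsubmxK _ 1 1 n); congr row_mx; apply/rowP => j.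
  rewrite (ord1 j) !mxE eqxx mulr1n /c1; congr (c _ _); exact: val_inj.
pose g (u : measurableTypeR R) :=
  lebesgue_rV [set x : 'rV[R]_n | A (row_mx (u%:M : 'M[R]_1) x)].
have mg : measurable_fun setT g by exact: measurable_slice_volume.
have g0 u : (0 <= g u)%E by exact: measure_ge0.
have sliceE t : ((\det M)%:E * lebesgue_rV [set x : 'rV[R]_n |
    A (row_mx (t%:M : 'M[R]_1) x *m
       (block_mx (a%:M : 'M[R]_1) v 0 M : 'M[R]_n.+1) + c)%R] = g (a * t + c1)%R)%E.
  rewrite /g -(volM (t *: v + c2)
    [set x : 'rV[R]_n | A (row_mx ((a * t + c1)%:M : 'M[R]_1) x)]); last first.
    have mr : measurable_fun setT (fun x : 'rV[R]_n =>
        row_mx ((a * t + c1)%:M : 'M[R]_1) x : 'rV[R]_n.+1).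
      exact: (measurable_fun_pair2 (a * t + c1) (@measurable_row_mx n)).
    by have := mr measurableT _ mA; rewrite setTI.
  congr (_ * lebesgue_rV _)%E; apply/funext => x /=; congr A.
  rewrite [X in _ + X]cE (@mul_row_block _ 1 1 n 1 n) mulmx0 addr0.
  rewrite -scalar_mxM mul_scalar_mx.
  rewrite [LHS](@add_row_mx _ 1 1 n) -[X in row_mx X _]raddfD/=.
  by rewrite mulrC [_ + x *m M]addrC addrA.
rewrite lebesgue_rVS [RHS]lebesgue_rVS -[RHS](integral_affine_line c1 a0 mg g0).
rewrite EFinM -muleA; congr (_ * _)%E.
rewrite -ge0_integralZl//; last 2 first.
- apply: measurable_slice_volume.
  have := @measurable_affine n.+1 n.+1
    (block_mx (a%:M : 'M[R]_1) v 0 M : 'M[R]_n.+1) c measurableT _ mA.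
  by rewrite setTI.
- by rewrite lee_fin ltW.
by apply: eq_integral => t _; exact: sliceE.
Qed.

Lemma scales_volume0 (M : 'M[R]_0) : scales_volume M.
Proof.
split; first by rewrite det_mx00.
move=> c A _; rewrite det_mx00 mul1e; congr lebesgue_rV.
by apply/funext => x /=; rewrite [x *m M + c]thinmx0 [x in RHS]thinmx0.
Qed.

Lemma scales_volume_scalar n (a : R) : 0 < a -> scales_volume (a%:M : 'M[R]_n).
Proof.
move=> a0; elim: n => [|n ih]; first exact: scales_volume0.
by rewrite -[n.+1]/(1 + n)%N scalar_mx_block; exact: scales_volume_block.
Qed.

Lemma lebesgue_rV_homothety n (a : R) (c : 'rV[R]_n) (A : set 'rV[R]_n) :
  0 < a -> measurable A ->
  ((a ^+ n)%:E * lebesgue_rV [set x | A (a *: x + c)%R] = lebesgue_rV A)%E.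
Proof.
move=> a0 mA; have [_ /(_ c A mA)] := scales_volume_scalar n a0.
by rewrite det_scalar; under eq_set do rewrite mul_mx_scalar.
Qed.

Lemma lebesgue_rV_shift n (c : 'rV[R]_n) (A : set 'rV[R]_n) :
  measurable A -> lebesgue_rV [set x | A (x + c)] = lebesgue_rV A.
Proof.
move=> mA; rewrite -(lebesgue_rV_homothety c ltr01 mA) expr1n mul1e.
by under [in RHS]eq_set do rewrite scale1r.
Qed.

End affine_images.

(** * Cubes: volume, boundedness and measurability of compact sets *)

Section cubes.
Context {R : realType}.

(** For [r >= 0] this is the closed ball at the origin for the norm of ['rV[R]_n], which is the sup
    norm. Being defined by coordinates, it is visibly measurable. *)
Definition cube n (r : R) : set 'rV[R]_n := [set x | forall i, `|x ord0 i| <= r].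

Lemma normr_rV_le n (x : 'rV[R]_n) (r : R) : 0 <= r -> (`|x| <= r) <-> cube r x.
Proof.
move=> r0; rewrite /Num.norm/= mx_normrE; split=> [/bigmax_leP[_ h] i|h].
  exact: (h (ord0, i)).
by apply/bigmax_leP; split=> // -[i j] _ /=; rewrite (ord1 i).
Qed.

Lemma measurable_cube n (r : R) : measurable (@cube n r).
Proof.
have -> : @cube n r = \bigcap_(i in [set: 'I_n])
    ((fun x : 'rV[R]_n => x ord0 i : measurableTypeR R) @^-1` `[- r, r]%classic).
  by apply/seteqP; split=> x /= h i; [move=> _|]; have := h i;
    rewrite /= in_itv/= -ler_norml//; exact.
apply: fin_bigcap_measurable; first exact: finite_finset.
move=> i _; rewrite -[_ @^-1` _]setTI.
by apply: (measurable_coord i) => //; exact: measurable_itv.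
Qed.

Lemma volume_cube n (r : R) : 0 <= r -> lebesgue_rV (@cube n r) = ((2 * r) ^+ n)%:E.
Proof.
move=> r0; elim: n => [|n ih].
  by rewrite expr0 /= diracE mem_set// => -[].
rewrite lebesgue_rVS exprSr EFinM.
pose I : set (measurableTypeR R) := `[- r, r]%classic.
have mI : measurable I by exact: measurable_itv.
(* The slice at [t] is the cube of one dimension less if [t] lies in [I], and is empty otherwise. *)
rewrite (eq_integral (fun t : measurableTypeR R => ((2 * r) ^+ n)%:E * (\1_I t)%:E)%E).
  rewrite ge0_integralZl//; last 2 first.
  - apply/measurable_EFinP.
    by exact (@measurable_indic _ (measurableTypeR R) R setT _ mI).
  - by rewrite lee_fin exprn_ge0// mulr_ge0.
  rewrite integral_indic//.
  rewrite setIT; congr (_ * _)%E.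
  apply: (eq_trans (lebesgue_measure_itv `[- r, r])); rewrite /= lte_fin.
  case: ltP => [_|rr]; first by rewrite -EFinB; congr EFin; ring.
  have -> : r = 0 by lra.
  by rewrite mulr0.
move=> t _; rewrite indicE.
have [tr|tr] := boolP (t \in I).
  rewrite mule1 -ih; congr lebesgue_rV; apply/seteqP; split => x /= h i.
    by have := h (rshift 1 i); rewrite (@row_mxEr _ 1 1 n).
  case: (@split_ordP 1 n i) => j ->; last by rewrite (@row_mxEr _ 1 1 n).
  rewrite (@row_mxEl _ 1 1 n) (ord1 j) mxE eqxx mulr1n.
  by move: tr; rewrite /I inE/= in_itv/= ler_norml.
rewrite mule0 -(measure0 (@lebesgue_rV R n)); congr lebesgue_rV.
apply/seteqP; split=> x //= h; have := h (lshift n (ord0 : 'I_1)).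
rewrite (@row_mxEl _ 1 1 n) mxE eqxx mulr1n => tr'.
by move/negP: tr; apply; rewrite /I inE/= in_itv/= -ler_norml.
Qed.

Lemma bounded_volume n (A : set 'rV[R]_n) (r : R) :
  measurable A -> A `<=` cube r -> (lebesgue_rV A < +oo)%E.
Proof.
move=> mA Ar.
apply: (@le_lt_trans _ _ (lebesgue_rV (@cube n `|r|))).
  apply: le_measure; rewrite ?inE//; first exact: measurable_cube.
  by move=> x /Ar h i; rewrite (le_trans (h i))// ler_norm.
by rewrite volume_cube// ltry.
Qed.

Lemma compact_subset_cube n (K : set 'rV[R]_n) : compact K ->
  exists2 r : R, 0 <= r & K `<=` cube r.
Proof.
move=> /compact_bounded[M [_ hM]]; exists (`|M| + 1) => [|x Kx].
  by rewrite addr_ge0.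
by apply/normr_rV_le; [rewrite addr_ge0|apply: hM => //; rewrite ltr_pwDr// ler_norm].
Qed.

Definition shifted_cube n (c : 'rV[R]_n) (r : R) : set 'rV[R]_n :=
  [set x | cube r (x - c)].

Lemma measurable_shifted_cube n (c : 'rV[R]_n) (r : R) :
  measurable (shifted_cube c r).
Proof.
have := @measurable_affine R n n 1%:M (- c) measurableT _ (@measurable_cube n r).
by rewrite setTI; under eq_fun do rewrite mulmx1.
Qed.

Lemma nbhs_volume_gt0 n (A : set 'rV[R]_n) (c : 'rV[R]_n) :
  measurable A -> nbhs c A -> (0 < lebesgue_rV A)%E.
Proof.
move=> mA /nbhs_ballP[e /= e0 eA].
(* Halving the radius puts a closed cube inside the open ball. *)
have e20 : 0 < e / 2 by rewrite divr_gt0.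
apply: (@lt_le_trans _ _ (lebesgue_rV (shifted_cube c (e / 2)))).
  rewrite [X in (_ < X)%E](@lebesgue_rV_shift _ _ (- c) (cube (e / 2))).
    by rewrite volume_cube ?ltW// lte_fin exprn_gt0// mulr_gt0.
  exact: measurable_cube.
apply: le_measure; rewrite ?inE//; first exact: measurable_shifted_cube.
move=> x /= xc; apply: eA; rewrite -ball_normE/= distrC.
by apply: normm_leW => //; apply/normr_rV_le => //; exact: ltW.
Qed.

(* Open sets are not known to be measurable for the sigma-algebra generated by
   the coordinates, so a compact set is exhibited as a countable intersection of
   finite unions of cubes. *)
Lemma compact_measurable n (K : set 'rV[R]_n) : compact K -> measurable K.
Proof.
move=> cK.
pose e (k : nat) : R := k.+1%:R^-1.
have e0 k : 0 < e k by rewrite invr_gt0.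
have ex k : exists L : {fset 'rV[R]_n}, {subset L <= K} /\
    K `<=` \bigcup_(c in [set` L]) shifted_cube c (e k).
  move: (cK); rewrite compact_cover => /(_ _ K (fun c => ball c (e k))) [].
  - by move=> c _; exact: ball_open.
  - by move=> x Kx; exists x => //; exact: ballxx.
  move=> L LK KL; exists L; split=> // x /KL[c cL]; rewrite -ball_normE/= => xc.
  exists c => //; apply/normr_rV_le; first exact: ltW.
  by rewrite distrC ltW.
have [L LP] := choice ex.
have -> : K = \bigcap_k (\bigcup_(c in [set` L k]) shifted_cube c (e k)).
  apply/seteqP; split=> [x Kx k _|x hx]; first exact: (LP k).2.
  (* The centers of the cubes belong to [K], so [x] has points of [K] at arbitrarily small distance;
     it remains that [K] is closed. *)
  have /closure_id -> := compact_closed (@norm_hausdorff _ _) cK.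
  move=> B /nbhs_ballP[r /= r0 rB].
  have [N _ /(_ N (leqnn N)) Nr] := near_infty_natSinv_lt (PosNum r0).
  have [c cL xc] := hx N Logic.I.
  exists c; split; first by apply/set_mem; exact: (LP N).1.
  apply: rB; rewrite -ball_normE/=; apply: le_lt_trans Nr.
  by apply/normr_rV_le => //; exact: ltW.
apply: bigcapT_measurable => k; apply: fin_bigcup_measurable.
  exact: finite_fset.
by move=> c _; exact: measurable_shifted_cube.
Qed.

End cubes.

(** * Cholesky factorization of positive definite matrices *)

Section cholesky.
Context {R : realType}.

Definition posdef n (S : 'M[R]_n) :=
  S^T = S /\ forall v : 'rV[R]_n, v != 0 -> 0 < (v *m S *m v^T) ord0 ord0.

(** Completing the square: the form at [(1, 0)] is [a], and its minimum over the first coordinate,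
    with the others equal to [u], is the form of the Schur complement at [u]. *)
Lemma posdef_schur n (a : R) (w : 'rV[R]_n) (P : 'M[R]_n) :
  posdef (block_mx (a%:M : 'M[R]_1) w w^T P) ->
  0 < a /\ posdef (P - a^-1 *: (w^T *m w)).
Proof.
move=> [symS posS].
have symP : P^T = P.
  by move: symS; rewrite tr_block_mx => /(congr1 drsubmx); rewrite !block_mxKdr.
have a0 : 0 < a.
  have := posS (row_mx 1%:M 0).
  rewrite mul_row_block !mul0mx !addr0 !mul1mx tr_row_mx mul_row_col trmx0.
  rewrite mulmx0 addr0 trmx1 mulmx1 mxE eqxx mulr1n; apply.
  apply/eqP => /(congr1 lsubmx); rewrite row_mxKl => /matrixP/(_ ord0 ord0).
  by rewrite !mxE eqxx mulr1n => /eqP; rewrite oner_eq0.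
split=> //; split=> [|u u0].
  by rewrite raddfB/= linearZ/= trmx_mul trmxK symP.
(* This first coordinate is the minimizer; it cancels the cross terms. *)
have := posS (row_mx (- a^-1 *: (u *m w^T)) u).
rewrite mul_row_block tr_row_mx mul_row_col.
have -> : (- a^-1 *: (u *m w^T)) *m a%:M + u *m w^T = 0.
  by rewrite mul_mx_scalar scalerA mulrN mulfV ?gt_eqF// scaleN1r addNr.
rewrite mul0mx add0r mulmxDl.
have -> : (- a^-1 *: (u *m w^T)) *m w *m u^T + u *m P *m u^T =
    u *m (P - a^-1 *: (w^T *m w)) *m u^T.
  rewrite mulmxBr mulmxBl -scalemxAr -!scalemxAl scaleNr addrC.
  by rewrite !mulmxA.
apply; apply: contra u0 => /eqP/(congr1 rsubmx); rewrite row_mxKr => ->.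
by apply/eqP/rowP => j; rewrite !mxE.
Qed.

(** Induction on the Schur complement. The factor is block upper triangular with first row
    [(sqrt a, w / sqrt a)], exactly the shape handled by [scales_volume_block]. *)
Lemma posdef_cholesky n (S : 'M[R]_n) : posdef S ->
  exists2 M : 'M[R]_n, scales_volume M & S = M^T *m M.
Proof.
elim: n S => [|n ih] S pS.
  by exists 0; [exact: scales_volume0|rewrite [LHS]thinmx0 [RHS]thinmx0].
pose S' : 'M[R]_(1 + n) := S.
pose a := S' ord0 ord0; pose w : 'rV[R]_n := ursubmx S'.
have SE : S' = block_mx (a%:M : 'M[R]_1) w w^T (drsubmx S').
  rewrite -[LHS]submxK; congr block_mx.
    apply/matrixP => i j; rewrite !ord1 !mxE eqxx mulr1n.
    by congr (S' _ _); exact: val_inj.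
  by rewrite /w trmx_ursub; case: pS => /= ->.
have : posdef S' by [].
rewrite SE => /posdef_schur[a0 /ih[M sM ME]].
pose al := Num.sqrt a.
have al0 : 0 < al by rewrite sqrtr_gt0.
have al2 : al * al = a by rewrite -expr2 sqr_sqrtr// ltW.
exists (block_mx (al%:M : 'M[R]_1) (al^-1 *: w) 0 M).
  exact: scales_volume_block.
transitivity S' => //.
rewrite SE (@tr_block_mx _ 1 n 1 n) (@mulmx_block _ 1 n 1 n 1 n).
rewrite !trmx0 !mul0mx !mulmx0 !addr0 tr_scalar_mx -scalar_mxM al2.
have <- : w = al%:M *m (al^-1 *: w).
  by rewrite mul_scalar_mx scalerA mulfV ?scale1r// gt_eqF.
have <- : w^T = (al^-1 *: w)^T *m al%:M.
  by rewrite linearZ/= mul_mx_scalar scalerA mulfV ?scale1r// gt_eqF.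
have -> : (al^-1 *: w)^T = al^-1 *: w^T by rewrite linearZ.
rewrite -ME -scalemxAl -scalemxAr scalerA -invfM al2.
by rewrite addrC subrK.
Qed.

End cholesky.

(** * From packings to coverings *)

Section packing.
Context {R : realType} {n : nat}.
Implicit Types A S W T : set 'rV[R]_n.

(** Let [L] be a largest set of points of [A] with disjoint translates [l + S]. These translates lie
    in [W], which bounds their number. By maximality [a + S] meets some [l + S], and
    [a + s' = l + s] means [a = l + (s - s')]. *)
Lemma packing_covering A S W :
  measurable S -> measurable W ->
  (0 < lebesgue_rV S)%E -> (lebesgue_rV W < +oo)%E ->
  (forall a s, A a -> S s -> W (a + s)) ->
  exists L : {fset 'rV[R]_n},
    ((#|` L|%:R)%:E * lebesgue_rV S <= lebesgue_rV W)%E /\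
    forall a, A a -> exists l s s', [/\ l \in L, S s, S s' & a = l + (s - s')].
Proof.
move=> mS mW S0 Woo ASW.
pose tr (l : 'rV[R]_n) : set 'rV[R]_n := [set x | S (x - l)].
have mtr l : measurable (tr l).
  have := @measurable_affine R n n 1%:M (- l) measurableT _ mS.
  by rewrite setTI; under eq_fun do rewrite mulmx1.
have vtr l : lebesgue_rV (tr l) = lebesgue_rV S by exact: lebesgue_rV_shift.
pose sep (L : {fset 'rV[R]_n}) := {subset L <= A} /\ trivIset [set` L] tr.
have volL L : sep L -> ((#|` L|%:R)%:E * lebesgue_rV S <= lebesgue_rV W)%E.
  move=> [LA tL].
  have <- : lebesgue_rV (\big[setU/set0]_(l <- L) tr l) =
      ((#|` L|%:R)%:E * lebesgue_rV S)%E.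
    rewrite measure_fbigsetU// (eq_bigr (fun=> lebesgue_rV S)) => [|l _].
      rewrite big_const_seq count_predT; elim: (size L) => [|m ih].
        by rewrite mul0e.
      by rewrite iterS ih -add1n natrD EFinD ge0_muleDl ?mul1e// lee_fin.
    exact: vtr.
  apply: le_measure; rewrite ?inE//.
    by apply: bigsetU_measurable => l _; exact: mtr.
  rewrite -bigcup_fset => x [l lL Sx].
  by rewrite -(subrK l x) addrC; apply: ASW => //; apply/set_mem/LA.
(* One translate of [S] inside [W] makes the volume of [S] finite; if [A] is empty, no translate is
   available but the empty covering works. *)
have Sfin : lebesgue_rV S \is a fin_num \/ ~ (A !=set0).
  have [[a Aa]|] := pselect (A !=set0); [left|by right].
  rewrite ge0_fin_numE ?measure_ge0//; apply: le_lt_trans Woo.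
  rewrite -(vtr a); apply: le_measure; rewrite ?inE//.
  by move=> x Sx; rewrite -(subrK a x) addrC; exact: ASW.
case: Sfin => [Sfin|A0]; last first.
  exists fset0; split; first by rewrite cardfs0 mul0e measure_ge0.
  by move=> a Aa; case: A0; exists a.
pose v := fine (lebesgue_rV S).
have vE : lebesgue_rV S = v%:E by rewrite fineK.
have v0 : 0 < v by rewrite -lte_fin -vE.
have WE : lebesgue_rV W = (fine (lebesgue_rV W))%:E.
  by rewrite fineK// ge0_fin_numE ?measure_ge0.
(* The volume bound on separated sets makes a maximal cardinality exist. *)
pose N := (Num.truncn (fine (lebesgue_rV W) / v)).
have cardL L : sep L -> (#|` L| <= N)%N.
  move=> /volL; rewrite vE WE -EFinM lee_fin -ler_pdivlMr// => h.
  by rewrite truncn_ge_nat// divr_ge0 ?fine_ge0 ?measure_ge0// ltW.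
pose P k := `[< exists2 L, sep L & #|` L| = k >].
have exP : exists k, P k.
  exists 0%N; apply/asboolP; exists fset0; last by rewrite cardfs0.
  by split=> [x|]; rewrite ?inE//; apply/trivIsetP => i j; rewrite /= inE.
have ubP k : P k -> (k <= N)%N by move=> /asboolP[L /cardL + <-].
case: (ex_maxnP exP ubP) => k /asboolP[L sL Lk] maxk.
exists L; split; first exact: volL.
move=> a Aa.
have [s0 Ss0] : S !=set0.
  by apply/set0P; apply: contraTneq S0 => ->; rewrite measure0 ltxx.
have [aL|aL] := boolP (a \in L).
  by exists a, s0, s0; split=> //; rewrite subrr addr0.
apply: contrapT => nex.
suff sL' : sep (a |` L)%fset.
  have : (k.+1 <= k)%N; last by rewrite ltnn.
  by apply: maxk; apply/asboolP; exists (a |` L)%fset => //; rewrite cardfsU1 aL Lk.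
have disj l x : l \in L -> tr l x -> tr a x -> False.
  move=> lL xl xa; apply: nex; exists l, (x - l), (x - a); split=> //.
  by rewrite addrA [l + _]addrC subrK subKr.
case: sL => LA tL; split.
  move=> x; rewrite in_fset1U => /orP[/eqP ->|xL].
    exact: mem_set.
  exact: LA.
move/trivIsetP : tL => tL; apply/trivIsetP => i j /=; rewrite !in_fset1U.
move=> /orP[/eqP ->|iL] /orP[/eqP ->|jL] ij.
- by rewrite eqxx in ij.
- by rewrite -subset0 => x [xa xj]; exact: (disj j x).
- by rewrite -subset0 => x [xi xa]; exact: (disj i x).
- exact: tL.
Qed.

Lemma covering_number_le A T (L : {fset 'rV[R]_n}) (b : R) :
  (forall a, A a -> exists l t, [/\ l \in L, T t & a = l + t]) ->
  (#|` L|)%:R <= b -> (covering_number A T <= b%:E)%E.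
Proof.
move=> AL Lb; apply: (@le_trans _ _ (#|` L|%:R)%:E); last by rewrite lee_fin.
apply: ereal_inf_lbound; exists L => //= a /AL[l [t [lL Tt ->]]].
by exists l => //; exists t.
Qed.

End packing.

(** * A center with a large symmetric part *)

Section symmetric_core.
Context {R : realType} {n : nat}.

Local Notation mu := (@lebesgue_rV R n).

(* Averaging [vol (A `&` (2 x - A))] over [x] gives [2 ^- n] times the volume of
   [A]; settling for [3 ^- n] avoids a discussion of equality. *)
Lemma exists_symmetric_core (A : set 'rV[R]_n) : (0 < n)%N ->
  measurable A -> (0 < lebesgue_rV A < +oo)%E ->
  (forall x y, A x -> A y -> A (2^-1 *: (x + y))) ->
  exists x : 'rV[R]_n, (lebesgue_rV A <
    (3 ^+ n)%:E * lebesgue_rV [set z | A (x + z)%R /\ A (x - z)%R])%E.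
Proof.
move=> n0 mA /andP[A0 Aoo] midA; apply: contrapT => nex.
(* The section of [Q] at a first coordinate [x] is the symmetric part of [A] about [x], translated
   by [x]. The section at a second coordinate [y] in [A] is [(A + y) / 2], of volume [2 ^- n] times
   that of [A]. *)
pose Q : set ('rV[R]_n * 'rV[R]_n) := [set p | A p.2 /\ A (2 *: p.1 - p.2)].
have mQ : measurable Q.
  rewrite (_ : Q = snd @^-1` A `&` (fun p => 2 *: p.1 - p.2) @^-1` A)//.
  apply: measurableI; first by rewrite -[X in measurable X]setTI; exact: measurable_snd.
  have m2 : measurable_fun [set: 'rV[R]_n * 'rV[R]_n] (fun p => 2 *: p.1 - p.2).
    apply: measurable_fun_rV => i.
    rewrite (_ : (fun _ => _) = (fun p : 'rV[R]_n * 'rV[R]_n =>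
      2 * p.1 ord0 i - p.2 ord0 i)); last by apply/funext => p; rewrite !mxE.
    apply: measurable_funB.
      apply: measurable_funM => //.
      by apply: (measurableT_comp (measurable_coord i)); exact: measurable_fst.
    by apply: (measurableT_comp (measurable_coord i)); exact: measurable_snd.
  by rewrite -[X in measurable X]setTI; exact: m2.
have xQ x : mu (xsection Q x) = mu [set z | A (x + z) /\ A (x - z)].
  have mx : measurable (xsection Q x) by exact: measurable_xsection.
  rewrite -(lebesgue_rV_shift x mx); congr lebesgue_rV.
  have e z : 2 *: x - (z + x) = x - z.
    by rewrite scaler_nat mulr2n opprD addrACA subrr addr0.
  by apply/seteqP; split=> z /=; rewrite /xsection/= inE /Q/= e addrC.
have yQ y : ((2 ^+ n)%:E * mu (ysection Q y) = mu A * (\1_A y)%:E)%E.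
  have [yA|yA] := boolP (y \in A); rewrite indicE ?yA ?(negbTE yA) /=.
    rewrite mule1 -(lebesgue_rV_homothety (- y) (ltr0n _ 2) mA).
    congr (_ * lebesgue_rV _)%E.
    apply/seteqP; split=> x /=; rewrite /ysection/= inE /Q/=; first by case.
    by split=> //; exact: set_mem.
  rewrite mule0; suff -> : ysection Q y = set0 by rewrite measure0 mule0.
  apply/seteqP; split=> x //; rewrite /ysection/= inE => -[/mem_set].
  by rewrite (negbTE yA).
(* Tonelli: the measure of [Q] may be computed by either family of sections. *)
have prodE : (mu \x mu)%E Q = (mu \x^ mu)%E Q.
  apply: product_measure_unique => // B C mB mC.
  exact: product_measure2E.
have mmA : measurable_fun setT (fun x => (\1_A x)%:E : \bar R).
  by apply/measurable_EFinP; exact: measurable_indic.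
have lower : ((2 ^+ n)%:E * (mu \x mu)%E Q = mu A * mu A)%E.
  rewrite prodE /product_measure2 -ge0_integralZl//; last 1 first.
    exact: measurable_fun_ysection.
  under eq_integral do rewrite /= yQ.
  by rewrite ge0_integralZl// integral_indic// setIT.
(* Integration of the negated conclusion over [x] in [A]; for [x] outside [A] the section is empty,
   since [x] would be the midpoint of two points of [A]. *)
have upper : ((3 ^+ n)%:E * (mu \x mu)%E Q <= mu A * mu A)%E.
  rewrite /product_measure1 -ge0_integralZl//; last 1 first.
    exact: measurable_fun_xsection.
  have -> : (mu A * mu A = \int[mu]_x (mu A * (\1_A x)%:E))%E.
    by rewrite ge0_integralZl// integral_indic// setIT.
  apply: ge0_le_integral => //.
  - by move=> x _; rewrite mule_ge0// lee_fin exprn_ge0.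
  - exact: (measurable_funeM _ (measurable_fun_xsection mu mQ)).
  - exact: measurable_funeM.
  move=> x _; rewrite /= xQ indicE.
  have [xA|xA] := boolP (x \in A).
    by rewrite mule1 leNgt; apply/negP => h; apply: nex; exists x.
  rewrite mule0 (_ : [set z | _] = set0) ?measure0 ?mule0//.
  apply/seteqP; split=> z //= [z1 z2]; move/negP: xA; apply; apply/mem_set.
  have := midA _ _ z1 z2; rewrite addrACA subrr addr0 -mulr2n -[x *+ 2]scaler_nat.
  by rewrite scalerA mulVf ?scale1r.
have AE : mu A = (fine (mu A))%:E by rewrite fineK// ge0_fin_numE ?measure_ge0.
have a0 : 0 < fine (mu A) by rewrite -lte_fin -AE.
have QE : (mu \x mu)%E Q = (fine ((mu \x mu)%E Q))%:E.
  rewrite fineK// ge0_fin_numE ?measure_ge0//; rewrite ltey; apply/eqP => Qoo.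
  by move: lower; rewrite Qoo gt0_muley ?lte_fin ?exprn_gt0// AE -EFinM.
(* With [P] the positive finite measure of [Q], the two estimates give [3 ^+ n * P <= 2 ^+ n * P],
   which is absurd as [n] is positive. *)
move: lower upper; rewrite QE AE -!EFinM => -[lower].
rewrite lee_fin -lower ler_pM2r; last first.
  rewrite -(pmulr_rgt0 _ (exprn_gt0 n (ltr0n _ 2))) lower; exact: mulr_gt0.
by rewrite leNgt (ltr_pXn2r n0) ?nnegrE ?ler0n// ltr_nat.
Qed.

End symmetric_core.

(** * Inner products and quadratic forms *)

Section inner_product.
Context {R : realType} {n : nat}.
Implicit Types x y z v : 'rV[R]_n.

Lemma rowvB x y i : (x - y) ord0 i = x ord0 i - y ord0 i.
Proof. by rewrite !mxE. Qed.

Lemma dotE x y : dot x y = \sum_i x ord0 i * y ord0 i.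
Proof. by rewrite /dot mxE; apply: eq_bigr => i _; rewrite mxE. Qed.

Lemma dotC x y : dot x y = dot y x.
Proof. by rewrite !dotE; apply: eq_bigr => i _; rewrite mulrC. Qed.

Lemma dotDr x y z : dot x (y + z) = dot x y + dot x z.
Proof. by rewrite /dot raddfD/= mulmxDr mxE. Qed.

Lemma dotZr (a : R) x y : dot x (a *: y) = a * dot x y.
Proof. by rewrite /dot linearZ/= -scalemxAr mxE. Qed.

Lemma dotNr x y : dot x (- y) = - dot x y.
Proof. by rewrite -scaleN1r dotZr mulN1r. Qed.

Lemma dotBr x y z : dot x (y - z) = dot x y - dot x z.
Proof. by rewrite dotDr dotNr. Qed.

Lemma dot_sqrD (t : R) x y :
  dot (x + t *: y) (x + t *: y) = dot x x + t * (2 * dot x y + t * dot y y).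
Proof.
rewrite dotDr dotZr ![dot (_ + _) _]dotC !dotDr !dotZr [dot y x]dotC; ring.
Qed.

Lemma dot_ge0 x : 0 <= dot x x.
Proof. by rewrite dotE; apply: sumr_ge0 => i _; rewrite -expr2 sqr_ge0. Qed.

Lemma dot_eq0 x : dot x x = 0 -> x = 0.
Proof.
rewrite dotE => /eqP; rewrite psumr_eq0 => [/allP h|i _]; last first.
  by rewrite -expr2 sqr_ge0.
apply/rowP => i; rewrite mxE; have := h i (mem_index_enum _).
by rewrite /= mulf_eq0 orbb => /eqP.
Qed.

Lemma continuous_sum (T : topologicalType) (I : Type) (t : seq I) (f : I -> T -> R) :
  (forall i, continuous (f i)) -> continuous (fun u => \sum_(i <- t) f i u).
Proof.
move=> cf; elim: t => [|i t ih].
  have -> : (fun u => \sum_(i <- [::]) f i u) = fun=> 0.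
    by apply/funext => u; rewrite big_nil.
  exact: cst_continuous.
have -> : (fun u => \sum_(j <- i :: t) f j u) =
    fun u => f i u + \sum_(j <- t) f j u.
  by apply/funext => u; rewrite big_cons.
by move=> u; exact: cvgD (cf i u) (ih u).
Qed.

Lemma continuous_mul (T : topologicalType) (f g : T -> R) :
  continuous f -> continuous g -> continuous (fun u => f u * g u).
Proof. by move=> cf cg u; exact: cvgM (cf u) (cg u). Qed.

Lemma continuous_sub (T : topologicalType) (f g : T -> R) :
  continuous f -> continuous g -> continuous (fun u => f u - g u).
Proof. by move=> cf cg u; exact: cvgB (cf u) (cg u). Qed.

Lemma continuous_dot x : continuous (dot x).
Proof.
have -> : dot x = fun y => \sum_i x ord0 i * y ord0 i.
  by apply/funext => y; rewrite dotE.
apply: continuous_sum => i; apply: continuous_mul; first exact: cst_continuous.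
exact: coord_continuous.
Qed.

Definition quad (A : 'M[R]_n) x : R := (x *m A *m x^T) ord0 ord0.

Lemma quadE A x : quad A x = \sum_i \sum_j A i j * (x ord0 i * x ord0 j).
Proof.
rewrite /quad -mulmxA mxE; apply: eq_bigr => i _.
rewrite mxE mulr_sumr; apply: eq_bigr => j _; rewrite mxE.
by rewrite mulrCA.
Qed.

Lemma quadZ A (a : R) x : quad A (a *: x) = a ^+ 2 * quad A x.
Proof.
by rewrite /quad linearZ/= -!scalemxAl -scalemxAr scalerA mxE expr2.
Qed.

Lemma quad_parallelogram A x y :
  quad A (x + y) + quad A (x - y) = 2 * quad A x + 2 * quad A y.
Proof.
rewrite /quad [(x + y)^T]linearD [(x - y)^T]linearB/=.
by rewrite !(mulmxDl, mulmxDr, mulNmx, mulmxN, opprK) !mxE; ring.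
Qed.

(** One nonnegative term of the parallelogram law is dropped. This stands in for the triangle
    inequality of the norm [sqrt (quad A x)]. *)
Lemma quadBr_le A x y : (forall z, 0 <= quad A z) ->
  quad A (x - y) <= 2 * quad A x + 2 * quad A y.
Proof. by move=> A0; rewrite -quad_parallelogram lerDr. Qed.

Lemma quadDr_le A x y : (forall z, 0 <= quad A z) ->
  quad A (x + y) <= 2 * quad A x + 2 * quad A y.
Proof. by move=> A0; rewrite -quad_parallelogram lerDl. Qed.

Lemma posdef_unitmx (A : 'M[R]_n) : posdef A -> A \in unitmx.
Proof.
by case/posdef_cholesky => M [M0 _] ->; rewrite unitmxE det_mulmx det_tr
  unitfE mulf_neq0 ?gt_eqF.
Qed.

(** The substitution [x = y *m A] turns the form of the inverse into that of [A]. *)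
Lemma quad_inv_ge0 (A : 'M[R]_n) x : posdef A -> 0 <= quad (invmx A) x.
Proof.
move=> pA; have uA := posdef_unitmx pA; have [symA posA] := pA.
have symV : (invmx A)^T = invmx A by rewrite trmx_inv symA.
have -> : quad (invmx A) x = quad A (x *m invmx A).
  by rewrite /quad trmx_mul symV !mulmxA mulmxKV.
have [->|x0] := eqVneq (x *m invmx A) 0; first by rewrite /quad !mul0mx mxE.
exact/ltW/posA.
Qed.

Lemma measurable_quad (A : 'M[R]_n) (b : 'rV[R]_n) :
  measurable_fun setT (fun x : 'rV[R]_n => quad A (x - b)).
Proof.
under eq_fun do rewrite quadE.
apply: measurable_sum => i; apply: measurable_sum => j.
apply: measurable_funM => //; apply: measurable_funM.
  under eq_fun do rewrite !mxE.
  by apply: measurable_funB => //; exact: measurable_coord.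
under eq_fun do rewrite !mxE.
by apply: measurable_funB => //; exact: measurable_coord.
Qed.

Lemma measurable_ellipsoid (A : 'M[R]_n) (b : 'rV[R]_n) (r : R) :
  measurable [set x | quad A (x - b) <= r].
Proof.
have := measurable_quad A b measurableT (measurable_itv `]-oo, r]).
by rewrite setTI.
Qed.

Lemma convex_setP (A : set 'rV[R]_n) : @convex_set R 'rV[R]_n A ->
  forall x y (t : R), 0 <= t <= 1 -> A x -> A y -> A (t *: x + (1 - t) *: y).
Proof.
move=> cA x y t /andP[t0 t1] Ax Ay.
by have /set_mem := cA x y (Itv01 t0 t1) (mem_set Ax) (mem_set Ay).
Qed.

End inner_product.

(** * Integration over a convex body, and its centroid *)

Section integration_on_body.
Context {R : realType} {n : nat} (K : set 'rV[R]_n) (hK : convex_body K).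
Implicit Types (g h : 'rV[R]_n -> R).

Local Notation mu := (@lebesgue_rV R n).

Lemma body_measurable : measurable K.
Proof. by case: hK => _ cK _; exact: compact_measurable. Qed.

Lemma body_volume_lty : (mu K < +oo)%E.
Proof.
case: hK => _ /compact_subset_cube[r _ Kr] _.
exact: bounded_volume body_measurable Kr.
Qed.

Lemma body_volumeE : mu K = (vol K)%:E.
Proof. by rewrite /vol fineK// ge0_fin_numE ?measure_ge0// body_volume_lty. Qed.

Lemma body_volume_gt0 : 0 < vol K.
Proof.
case: hK => _ _ [c Kc]; rewrite -lte_fin -body_volumeE.
exact: nbhs_volume_gt0 body_measurable Kc.
Qed.

(** A class of integrands closed under sums, products and exponentials; its members are integrable
    over [K] because [K] has finite volume. Integrability side conditions thereby reduce to the
    shape of the integrand. *)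
Definition bounded_measurable g :=
  measurable_fun setT g /\ exists M, forall x, K x -> `|g x| <= M.

Lemma bounded_measurable_cst (c : R) : bounded_measurable (fun=> c).
Proof. by split; [exact: measurable_cst|exists `|c|]. Qed.

Lemma bounded_measurable_coord i : bounded_measurable (fun x => x ord0 i).
Proof.
split; first exact: measurable_coord.
case: hK => _ /compact_subset_cube[r _ Kr] _.
by exists r => x /Kr; exact.
Qed.

Lemma bounded_measurableD g h : bounded_measurable g -> bounded_measurable h ->
  bounded_measurable (fun x => g x + h x).
Proof.
move=> [mg [M gM]] [mh [N hN]]; split; first exact: measurable_funD.
by exists (M + N) => x Kx; rewrite (le_trans (ler_normD _ _))// lerD ?gM ?hN.
Qed.

Lemma bounded_measurableM g h : bounded_measurable g -> bounded_measurable h ->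
  bounded_measurable (fun x => g x * h x).
Proof.
move=> [mg [M gM]] [mh [N hN]]; split; first exact: measurable_funM.
by exists (M * N) => x Kx; rewrite normrM ler_pM ?gM ?hN.
Qed.

Lemma bounded_measurable_sum (I : Type) (t : seq I) (g : I -> 'rV[R]_n -> R) :
  (forall i, bounded_measurable (g i)) ->
  bounded_measurable (fun x => \sum_(i <- t) g i x).
Proof.
move=> bg; elim: t => [|i t ih].
  by under eq_fun do rewrite big_nil; exact: bounded_measurable_cst.
by under eq_fun do rewrite big_cons; exact: bounded_measurableD.
Qed.

Lemma bounded_measurable_dot (s : 'rV[R]_n) : bounded_measurable (dot s).
Proof.
rewrite (_ : dot s = fun x => \sum_i s ord0 i * x ord0 i); last first.
  by apply/funext => x; rewrite dotE.
apply: bounded_measurable_sum => i; apply: bounded_measurableM.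
  exact: bounded_measurable_cst.
exact: bounded_measurable_coord.
Qed.

Lemma bounded_measurable_expR g : bounded_measurable g ->
  bounded_measurable (fun x => expR (g x)).
Proof.
move=> [mg [M gM]]; split; first exact: measurableT_comp.
exists (expR M) => x Kx; rewrite ger0_norm ?expR_ge0// ler_expR.
exact: le_trans (ler_norm _) (gM _ Kx).
Qed.

Lemma bounded_measurable_integrable g : bounded_measurable g ->
  mu.-integrable K (EFin \o g).
Proof.
move=> [mg [M gM]]; apply: measurable_bounded_integrable.
- exact: body_measurable.
- exact: body_volume_lty.
- exact: measurable_funTS.
exists M; split; first exact: num_real.
by move=> N MN x Kx; apply: le_trans (gM x Kx) (ltW MN).
Qed.

Local Notation J g := (\int[mu]_(x in K) g x).

Lemma integral_body_cst (c : R) : J (fun=> c) = c * vol K.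
Proof. by rewrite Rintegral_cst//; exact: body_measurable. Qed.

Lemma integral_bodyD g h : bounded_measurable g -> bounded_measurable h ->
  J (fun x => g x + h x) = J g + J h.
Proof.
by move=> bg bh; rewrite RintegralD//;
  [exact: body_measurable|exact: bounded_measurable_integrable..].
Qed.

Lemma integral_bodyZ (c : R) g : bounded_measurable g ->
  J (fun x => c * g x) = c * J g.
Proof.
by move=> bg; rewrite RintegralZl//;
  [exact: body_measurable|exact: bounded_measurable_integrable].
Qed.

Lemma integral_body_sum (I : Type) (t : seq I) (g : I -> 'rV[R]_n -> R) :
  (forall i, bounded_measurable (g i)) ->
  J (fun x => \sum_(i <- t) g i x) = \sum_(i <- t) J (g i).
Proof.
move=> bg; elim: t => [|i t ih].
  rewrite big_nil; under eq_Rintegral do rewrite big_nil.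
  by rewrite (integral_body_cst 0) mul0r.
under eq_Rintegral do rewrite big_cons.
by rewrite big_cons integral_bodyD ?ih//; exact: bounded_measurable_sum.
Qed.

Lemma le_integral_body g h : bounded_measurable g -> bounded_measurable h ->
  (forall x, K x -> g x <= h x) -> J g <= J h.
Proof.
move=> bg bh gh; apply: le_Rintegral => //.
- exact: body_measurable.
- exact: bounded_measurable_integrable.
- exact: bounded_measurable_integrable.
Qed.

Lemma integral_body_dot (s : 'rV[R]_n) : J (dot s) = vol K * dot s (centroid K).
Proof.
rewrite (@eq_Rintegral _ _ _ mu K (fun x => \sum_i s ord0 i * x ord0 i)); last first.
  by move=> x _; rewrite dotE.
rewrite integral_body_sum => [|i]; last first.
  apply: bounded_measurableM; first exact: bounded_measurable_cst.
  exact: bounded_measurable_coord.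
rewrite dotE mulr_sumr; apply: eq_bigr => i _.
rewrite integral_bodyZ ?mxE; last exact: bounded_measurable_coord.
by rewrite [RHS]mulrCA mulVKf// gt_eqF// body_volume_gt0.
Qed.

(* If p is the point of K closest to the centroid c, then <p - c, x - c> is at
   least |p - c|^2 on K, while its integral over K vanishes. *)
Lemma centroid_body : K (centroid K).
Proof.
have [cvxK cK [k0 /nbhs_singleton Kk0]] := hK.
set c := centroid K.
have cN : continuous (fun x : 'rV[R]_n => dot (x - c) (x - c)).
  have -> : (fun x : 'rV[R]_n => dot (x - c) (x - c)) =
      fun x => \sum_i (x ord0 i - c ord0 i) ^+ 2.
    by apply/funext => x; rewrite dotE; apply: eq_bigr => i _; rewrite !mxE -expr2.
  have ci i : continuous (fun x : 'rV[R]_n => x ord0 i - c ord0 i).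
    by apply: continuous_sub; [exact: coord_continuous|exact: cst_continuous].
  by apply: continuous_sum => i; exact: continuous_mul.
have [p /set_mem Kp minp] := @compact_EVT_min _ R _ K
  (ex_intro _ k0 Kk0) cK (continuous_subspaceT cN).
suff pc : p = c by rewrite -pc.
have obtuse x : K x -> 0 <= dot (p - c) (x - p).
  move=> Kx; rewrite leNgt; apply/negP => a0.
  set a := dot (p - c) (x - p) in a0; pose B := dot (x - p) (x - p).
  have B0 : 0 <= B by exact: dot_ge0.
  (* Moving from [p] towards [x] by [t] changes the squared distance to [c] by
     [t * (2 * a + t * B)]. This [t] lies in []0, 1]] and satisfies [t * B <= - a], so the change is
     at most [t * a < 0], against the minimality of [p]. *)
  pose t := - a / (B - a).
  have Ba : 0 < B - a by rewrite subr_gt0 (lt_le_trans a0).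
  have t0 : 0 < t by rewrite divr_gt0// oppr_gt0.
  have t1 : t <= 1 by rewrite ler_pdivrMr// mul1r lerDr.
  have Ky : K (t *: x + (1 - t) *: p).
    by apply: (convex_setP cvxK) => //; rewrite (ltW t0) t1.
  have := minp _ (mem_set Ky).
  have -> : t *: x + (1 - t) *: p - c = (p - c) + t *: (x - p).
    by apply/rowP => i; rewrite !mxE; ring.
  rewrite dot_sqrD -/a -/B lerDl => h.
  have tB : t * B <= - a.
    rewrite /t mulrAC ler_pdivrMr// ler_wpM2l//; lra.
  have : t * (2 * a + t * B) < 0 by rewrite pmulr_rlt0//; lra.
  by rewrite ltNge h.
have bm : bounded_measurable (dot (p - c)) by exact: bounded_measurable_dot.
have := @le_integral_body (fun=> dot (p - c) (p - c))
  (fun x => dot (p - c) x + - dot (p - c) c).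
rewrite integral_body_cst integral_bodyD//; last exact: bounded_measurable_cst.
rewrite integral_body_cst integral_body_dot -/c.
rewrite mulrC mulNr [dot _ c * _]mulrC subrr.
move=> /(_ (bounded_measurable_cst _) (bounded_measurableD bm (bounded_measurable_cst _))).
rewrite pmulr_rle0 ?body_volume_gt0// => h.
apply/eqP; rewrite -subr_eq0; apply/eqP/dot_eq0/eqP.
rewrite eq_le dot_ge0 h// => x Kx.
rewrite -dotBr (_ : x - c = (x - p) + (p - c)); last by rewrite addrA subrK.
by rewrite [leRHS]dotDr lerDr obtuse.
Qed.

(** If the integral vanished, [g] would vanish on [K] outside a null set; that null set would
    contain a neighbourhood of [c], which has positive volume. *)
Lemma integral_body_gt0 g (c : 'rV[R]_n) : bounded_measurable g ->
  (forall x, K x -> 0 <= g x) -> nbhs c [set x | K x /\ g x != 0] -> 0 < J g.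
Proof.
move=> bg g0 nc; rewrite lt_neqAle Rintegral_ge0// andbT; apply/negP => /eqP J0.
have mK := body_measurable.
have ig := bounded_measurable_integrable bg.
have : (\int[mu]_(x in K) `|(EFin \o g) x| = 0)%E.
  rewrite (eq_integral (EFin \o g)) => [|x /set_mem Kx]; last first.
    by rewrite /= ger0_norm// g0.
  by rewrite -[LHS]fineK ?integrable_fin_num//; congr EFin; exact/esym.
have mg : measurable_fun K (EFin \o g).
  by apply/measurable_EFinP; apply: measurable_funTS; case: bg.
move=> /(ae_eq_integral_abs mu mK mg)[N [mN N0 subN]].
have : (0 < mu N)%E.
  apply: (@nbhs_volume_gt0 _ _ _ c) => //; apply: filterS nc => x [Kx gx].
  apply: subN => /= /(_ Kx) [gx0].
  by rewrite gx0 eqxx in gx.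
by rewrite N0 ltxx.
Qed.

End integration_on_body.

(** * Mass, covariance and central part of the exponential density *)

Section exponential_moments.
Context {R : realType} {n : nat} (K : set 'rV[R]_n) (hK : convex_body K).
Context (s : 'rV[R]_n).

Local Notation mu := (@lebesgue_rV R n).
Local Notation J g := (\int[mu]_(x in K) g x).
Local Notation f := (exp_on K s).
Local Notation e := (fun x => expR (dot s x)).
Local Notation Z := (integral_rV f).
Local Notation b := (barycenter f).
Local Notation C := (covar f).

Lemma integral_exp_on (g : 'rV[R]_n -> R) :
  integral_rV (fun x => g x * f x) = J (fun x => g x * e x).
Proof.
rewrite /integral_rV [RHS]Rintegral_mkcond; apply: eq_Rintegral => x _.
by rewrite patchE /exp_on; case: ifP => // _; rewrite mulr0.
Qed.

Lemma mass_exp_on : Z = J e.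
Proof.
rewrite [RHS](@eq_Rintegral _ _ _ mu K (fun x => 1 * e x)).
  by rewrite -integral_exp_on; apply: eq_Rintegral => x _; rewrite mul1r.
by move=> x _; rewrite mul1r.
Qed.

Lemma bounded_measurable_exp : bounded_measurable K e.
Proof. exact/bounded_measurable_expR/bounded_measurable_dot. Qed.

Let be := bounded_measurable_exp.

Lemma mass_exp_on_gt0 : 0 < Z.
Proof.
rewrite mass_exp_on; have [_ _ [c Kc]] := hK.
apply: (integral_body_gt0 hK (c := c)) => //.
by apply: filterS Kc => x Kx; split=> //; rewrite gt_eqF// expR_gt0.
Qed.

Let bcoord (i : 'I_n) : bounded_measurable K (fun x : 'rV[R]_n => x ord0 i - b ord0 i).
Proof.
apply: bounded_measurableD; first exact: bounded_measurable_coord.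
exact: bounded_measurable_cst.
Qed.

Let bcov (i j : 'I_n) : bounded_measurable K
  (fun x : 'rV[R]_n => (x ord0 i - b ord0 i) * (x ord0 j - b ord0 j) * e x).
Proof. by apply: bounded_measurableM => //; exact: bounded_measurableM. Qed.

Lemma covar_exp_onE i j :
  Z * C i j = J (fun x : 'rV[R]_n => (x ord0 i - b ord0 i) * (x ord0 j - b ord0 j) * e x).
Proof.
rewrite mxE mulrC divfK ?gt_eqF ?mass_exp_on_gt0// integral_exp_on.
apply: eq_Rintegral => x _; congr (_ * _).
by rewrite mxE big_ord1 mxE !rowvB.
Qed.

Lemma bounded_measurable_quad (A : 'M[R]_n) :
  bounded_measurable K (fun x => quad A (x - b)).
Proof.
under eq_fun do rewrite quadE.
apply: bounded_measurable_sum => i; apply: bounded_measurable_sum => j.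
apply: bounded_measurableM; first exact: bounded_measurable_cst.
by under eq_fun do rewrite !rowvB; exact: bounded_measurableM.
Qed.

Lemma quad_moment (A : 'M[R]_n) :
  J (fun x => quad A (x - b) * e x) = Z * \sum_i \sum_j A i j * C i j.
Proof.
rewrite (@eq_Rintegral _ _ _ mu K (fun x : 'rV[R]_n => \sum_i \sum_j
   A i j * ((x ord0 i - b ord0 i) * (x ord0 j - b ord0 j) * e x))); last first.
  move=> x _; rewrite quadE mulr_suml; apply: eq_bigr => i _.
  by rewrite mulr_suml; apply: eq_bigr => j _; rewrite !rowvB -mulrA.
have bA i j : bounded_measurable K (fun x : 'rV[R]_n =>
    A i j * ((x ord0 i - b ord0 i) * (x ord0 j - b ord0 j) * e x)).
  by apply: bounded_measurableM => //; exact: bounded_measurable_cst.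
rewrite (integral_body_sum hK) => [|i]; last exact: bounded_measurable_sum.
rewrite mulr_sumr; apply: eq_bigr => i _; rewrite (integral_body_sum hK)//.
rewrite mulr_sumr; apply: eq_bigr => j _.
by rewrite (integral_bodyZ hK)// -covar_exp_onE mulrCA.
Qed.

Lemma covar_sym : C^T = C.
Proof.
apply/matrixP => i j; rewrite mxE.
apply: (mulfI (lt0r_neq0 mass_exp_on_gt0)); rewrite !covar_exp_onE.
by apply: eq_Rintegral => x _; rewrite [_ * (x ord0 j - _)]mulrC.
Qed.

(** Up to the factor [Z], the form at [v] is the integral of [dot v (x - b) ^+ 2] against the
    density. The integrand vanishes only on a hyperplane, which cannot contain the interior of
    [K]. *)
Lemma covar_posdef : posdef C.
Proof.
split=> [|v v0]; first exact: covar_sym.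
have qv y : quad (v^T *m v) y = dot v y ^+ 2.
  rewrite /quad mulmxA -mulmxA [y *m v^T]mx11_scalar mul_scalar_mx mxE.
  by rewrite -/(dot y v) -/(dot v y) dotC expr2.
have -> : (v *m C *m v^T) ord0 ord0 = \sum_i \sum_j (v^T *m v) i j * C i j.
  rewrite -/(quad C v) quadE; apply: eq_bigr => i _; apply: eq_bigr => j _.
  by rewrite !mxE big_ord1 !mxE mulrC.
rewrite -(pmulr_rgt0 _ mass_exp_on_gt0) -quad_moment.
have [_ _ [k Kk]] := hK.
have [c Kc vc] : exists2 c, K° c & dot v (c - b) != 0.
  have [vk|] := eqVneq (dot v (k - b)) 0; last by exists k.
  have /nbhs_interior/nbhs_ballP[r /= r0 rK] := Kk.
  (* If [k] lies on the hyperplane, [k + t *: v] leaves it; this [t] keeps the displacement below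
     [r]. *)
  pose t := r / (`|v| + 1) / 2.
  have v1 : 0 < `|v| + 1 by rewrite ltr_wpDl.
  have t0 : 0 < t by rewrite !divr_gt0.
  exists (k + t *: v).
    apply: rK; rewrite -ball_normE/= opprD addNKr normrN normrZ gtr0_norm//.
    have : `|v| <= `|v| + 1 by rewrite lerDl.
    move=> /(ler_wpM2l (ltW t0))/le_lt_trans; apply.
    by rewrite /t mulrAC divfK ?gt_eqF// ltr_pdivrMr// ltr_pMr// ltrDl.
  rewrite addrAC dotDr vk add0r dotZr mulf_neq0//; first by rewrite gt_eqF.
  by move: v0; apply: contra_neq => /dot_eq0.
apply: (integral_body_gt0 hK (c := c)).
- by apply: bounded_measurableM => //; exact: bounded_measurable_quad.
- by move=> x _; rewrite qv mulr_ge0 ?sqr_ge0 ?expR_ge0.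
have nv : nbhs c [set x | dot v (x - b) != 0].
  have cv : continuous (fun x : 'rV[R]_n => dot v x - dot v b).
    by apply: continuous_sub; [exact: continuous_dot|exact: cst_continuous].
  have vcb : dot v c - dot v b != 0 by rewrite -dotBr.
  have : nbhs c ((fun x : 'rV[R]_n => dot v x - dot v b) @^-1` [set y | y != 0]).
    by apply: cv; apply: open_nbhs_nbhs; split; [exact: open_neq|].
  by apply: filterS => x /=; rewrite dotBr.
apply: filterS2 Kc nv => x Kx vx; split=> //=.
by rewrite qv mulf_neq0 ?expf_neq0// gt_eqF// expR_gt0.
Qed.

(** The double sum in [quad_moment] is here the trace of [invmx C *m C], that is, of the
    identity. *)
Lemma inverse_covar_moment : J (fun x => quad (invmx C) (x - b) * e x) = Z * n%:R.
Proof.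
rewrite quad_moment; congr (_ * _).
transitivity (\tr (invmx C *m C)).
  apply: eq_bigr => i _; rewrite mxE; apply: eq_bigr => j _.
  by congr (_ * _); rewrite -[in LHS]covar_sym [LHS]mxE.
by rewrite mulVmx ?posdef_unitmx ?mxtrace1//; exact: covar_posdef.
Qed.

(** The set [K0] of the overview: the form being quadratic, [b + 2 D] is given by the threshold
    [4 * n]. *)
Definition central_part : set 'rV[R]_n :=
  K `&` [set x | quad (invmx C) (x - b) <= 4 * n%:R].

Lemma measurable_central_part : measurable central_part.
Proof.
apply: measurableI; first exact: body_measurable.
exact: measurable_ellipsoid.
Qed.

Lemma volume_central_part : mu central_part = (vol central_part)%:E.
Proof.
rewrite /vol fineK// ge0_fin_numE ?measure_ge0//.
apply: le_lt_trans (body_volume_lty hK); apply: le_measure; rewrite ?inE.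
- exact: measurable_central_part.
- exact: body_measurable.
- by move=> x [].
Qed.

(* Chebyshev's inequality: the quadratic form of the inverse covariance has mean
   n, so it exceeds 4 n on at most a quarter of the mass. *)
Lemma mass_le_central_part (M : R) : (0 < n)%N -> (forall x, K x -> e x <= M) ->
  3 / 4 * Z <= M * vol central_part.
Proof.
move=> n0 eM.
have n0' : 0 < n%:R :> R by rewrite ltr0n.
(* Both sides become integrals over [K], and the claim is then the pointwise bound of
   [e * (1 - q / (4 n))] by [M] times the indicator of the central part. *)
have -> : 3 / 4 * Z = J (fun x => e x + - (4 * n%:R)^-1 *
    (quad (invmx C) (x - b) * e x)).
  have bq := bounded_measurable_quad (invmx C).
  have bqe := bounded_measurableM bq be.
  rewrite (integral_bodyD hK)// ?(integral_bodyZ hK)//; last first.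
    by apply: bounded_measurableM => //; exact: bounded_measurable_cst.
  rewrite inverse_covar_moment -mass_exp_on; field.
  by rewrite gt_eqF.
have -> : M * vol central_part = J (fun x => M * \1_central_part x).
  have mc := measurable_central_part.
  rewrite (integral_bodyZ hK); last first.
    split; first exact: measurable_indic.
    by exists 1 => x _; rewrite indicE; case: (_ \in _); rewrite ?normr1 ?normr0.
  congr (_ * _); rewrite /Rintegral integral_indic//; last exact: body_measurable.
  by rewrite setIidl// => x [].
apply: (le_integral_body hK).
- apply: bounded_measurableD => //; apply: bounded_measurableM.
    exact: bounded_measurable_cst.
  by apply: bounded_measurableM => //; exact: bounded_measurable_quad.
- apply: bounded_measurableM; first exact: bounded_measurable_cst.
  split; first by have mc := measurable_central_part; exact: measurable_indic.
  by exists 1 => x _; rewrite indicE; case: (_ \in _); rewrite ?normr1 ?normr0.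
move=> x Kx; have e0 := expR_gt0 (dot s x).
rewrite indicE; have [xc|xc] := boolP (x \in central_part).
  rewrite mulr1; apply: le_trans (eM x Kx).
  rewrite gerDl mulNr oppr_le0 mulr_ge0// ?invr_ge0 ?mulr_ge0 ?ler0n ?(ltW e0)//.
  exact/quad_inv_ge0/covar_posdef.
rewrite mulr0 mulNr subr_le0 mulrA ler_peMl ?(ltW e0)//.
have q4 : 4 * n%:R < quad (invmx C) (x - b).
  by rewrite ltNge; apply: contra xc => h; rewrite inE; split.
by rewrite mulrC ler_pdivlMr ?mulr_gt0// mul1r ltW.
Qed.

(** The exponential lies above its tangent at [u]. Integrated over [K], the linear term of the
    tangent vanishes because [u] is the value of [dot s] at the centroid. *)
Lemma jensen_exp : vol K * expR (dot s (centroid K)) <= Z.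
Proof.
set u := dot s (centroid K); rewrite mass_exp_on.
have -> : vol K * expR u = J (fun x => expR u * (dot s x + (1 - u))).
  have bd := bounded_measurable_dot hK s.
  have bc := bounded_measurable_cst K (1 - u).
  rewrite (integral_bodyZ hK); last exact: bounded_measurableD.
  rewrite (integral_bodyD hK)// (integral_body_cst hK) (integral_body_dot hK) -/u.
  ring.
apply: (le_integral_body hK) => //.
  apply: bounded_measurableM; first exact: bounded_measurable_cst.
  apply: bounded_measurableD; first exact: bounded_measurable_dot.
  exact: bounded_measurable_cst.
move=> x _; rewrite -[leRHS](_ : expR u * expR (dot s x - u) = _); last first.
  by rewrite -expRD addrC subrK.
rewrite ler_pM2l ?expR_gt0//; apply: le_trans (expR_ge1Dx _).
by rewrite addrCA.
Qed.

End exponential_moments.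

(** * Sublevel sets of quadratic forms and their volumes *)

Section ellipsoids.
Context {R : realType} {n : nat}.

Lemma scale_set_quad (A : 'M[R]_n) (r : R) : 0 < r ->
  scale_set r [set x | quad A x <= 1] = [set x | quad A x <= r ^+ 2].
Proof.
move=> r0; apply/seteqP; split=> x /= [].
  by move=> y y1 <-; rewrite quadZ ler_piMr// exprn_ge0// ltW.
move=> xr; exists (r^-1 *: x); last by rewrite scalerA mulfV ?scale1r// gt_eqF.
by rewrite /= quadZ exprVn mulrC ler_pdivrMr ?exprn_gt0// mul1r.
Qed.

Lemma eucl_ballE : @eucl_ball R n = [set x | quad 1%:M x <= 1].
Proof.
apply/seteqP; split=> x; rewrite /eucl_ball/= /quad mulmx1 -/(dot x x).
  by rewrite -[leRHS]sqrtr1 ler_sqrt.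
by move=> x1; rewrite -[leRHS]sqrtr1 ler_sqrt.
Qed.

Lemma measurable_quad_le (A : 'M[R]_n) (r : R) :
  measurable [set x : 'rV[R]_n | quad A x <= r].
Proof.
by have := measurable_ellipsoid A 0 r; under eq_set do rewrite subr0.
Qed.

(** For a factorization [C = M^T *m M], the map [x |-> x *m M] carries Euclidean balls to sublevel
    sets of the inverse form, with [\det M] equal to [sqrt (\det C)]; a homothety then accounts for
    [a]. *)
Lemma volume_quad_le (C : 'M[R]_n) (a r : R) : posdef C -> 0 < a ->
  lebesgue_rV [set x | quad (invmx C) x <= a ^+ 2 * r] =
  ((a ^+ n * Num.sqrt (\det C))%:E *
    lebesgue_rV [set x : 'rV[R]_n | quad 1%:M x <= r]%R)%E.
Proof.
move=> /posdef_cholesky[M [M0 volM] ->] a0.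
have uM : M \in unitmx by rewrite unitmxE unitfE gt_eqF.
have -> : Num.sqrt (\det (M^T *m M)) = \det M.
  by rewrite det_mulmx det_tr -expr2 sqrtr_sqr gtr0_norm.
have invS : invmx (M^T *m M) = invmx M *m invmx M^T.
  have uS : M^T *m M \in unitmx by rewrite unitmx_mul unitmx_tr uM.
  rewrite -[RHS](mulmxK uS) -[LHS]mul1mx; congr (_ *m _).
  by rewrite !mulmxA mulmxKV ?unitmx_tr// mulVmx.
rewrite -(volM 0); last exact: measurable_quad_le.
rewrite (mulrC (a ^+ n)) EFinM -muleA; congr (_ * _)%E.
have -> : [set x : 'rV[R]_n | quad (invmx (M^T *m M)) (x *m M + 0) <= a ^+ 2 * r] =
    [set x | quad 1%:M x <= a ^+ 2 * r].
  apply/funext => x /=; rewrite addr0 /quad invS.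
  by rewrite !trmx_mul !mulmxA mulmxK// mulmxKV ?unitmx_tr// mulmx1.
rewrite -(lebesgue_rV_homothety 0 a0 (measurable_quad_le 1%:M (a ^+ 2 * r))).
congr (_ * lebesgue_rV _)%E; apply/funext => x /=.
by rewrite addr0 quadZ ler_pM2l// exprn_gt0.
Qed.

End ellipsoids.

(** * The two covering estimates *)

Section coverings.
Context {R : realType} {n : nat} (K : set 'rV[R]_n) (hK : convex_body K).
Context (s : 'rV[R]_n).

Local Notation mu := (@lebesgue_rV R n).
Local Notation f := (exp_on K s).
Local Notation Z := (integral_rV f).
Local Notation b := (barycenter f).
Local Notation q := (quad (invmx (covar f))).
Local Notation K0 := (central_part K s).

Let q_ge0 x : 0 <= q x.
Proof. exact/quad_inv_ge0/covar_posdef. Qed.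

Let f_body x : K x -> f x = expR (dot s x).
Proof. by move=> Kx; rewrite /exp_on mem_set. Qed.

Lemma exp_on_has_ubound (A : set 'rV[R]_n) : has_ubound [set f x | x in A].
Proof.
have [_ [M hM]] := bounded_measurable_exp hK s.
exists `|M| => _ [x _ <-]; rewrite /exp_on; case: ifPn => // /set_mem Kx.
apply: le_trans (ler_norm _) (le_trans (hM x Kx) (ler_norm _)).
Qed.

Lemma exp_on_le_sup (A : set 'rV[R]_n) x : A x -> f x <= sup [set f x | x in A].
Proof. by move=> Ax; apply: ub_le_sup; [exact: exp_on_has_ubound|exists x]. Qed.

(** The set [A] is left free because the first estimate takes the supremum over [K], whereas the
    isotropic constant takes it over the whole space. *)
Let volume_central_bound (A : set 'rV[R]_n) : (0 < n)%N -> K `<=` A ->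
  3 / 4 * Z <= sup [set f x | x in A] * vol K0.
Proof.
move=> n0 KA; apply: mass_le_central_part => // x Kx.
by rewrite -f_body//; exact/exp_on_le_sup/KA.
Qed.

Lemma sup_exp_on_gt0 (A : set 'rV[R]_n) : K `<=` A -> 0 < sup [set f x | x in A].
Proof.
move=> KA; have Kc := centroid_body hK.
by apply: lt_le_trans (exp_on_le_sup (KA _ Kc)); rewrite f_body// expR_gt0.
Qed.

Lemma central_part_volume_gt0 : (0 < n)%N -> 0 < vol K0.
Proof.
move=> n0; have := volume_central_bound n0 (fun _ => id).
have := sup_exp_on_gt0 (fun _ => id); have := mass_exp_on_gt0 hK s.
move=> Z0 S0 h; rewrite -(pmulr_rgt0 _ S0); apply: lt_le_trans h.
by rewrite mulr_gt0.
Qed.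

(** [K0 - K0] lies in [4 D], since [2 * 4 n + 2 * 4 n = 16 n]. *)
Lemma central_part_sub x y : K0 x -> K0 y -> q (x - y) <= 16 * n%:R.
Proof.
move=> [_ /= qx] [_ /= qy].
have -> : x - y = (x - b) - (y - b) by rewrite opprB addrA subrK.
apply: le_trans (quadBr_le _ _ q_ge0) _; lra.
Qed.

(** The factor [1/4] from halving exactly offsets the loss in [quadDr_le]. This is the hypothesis
    required for a symmetric core. *)
Lemma central_part_midpoint x y : K0 x -> K0 y -> K0 (2^-1 *: (x + y)).
Proof.
move=> [Kx /= qx] [Ky /= qy]; split.
  have [cK _ _] := hK.
  have h : 1 - 2^-1 = 2^-1 :> R by field.
  have := convex_setP cK (t := 2^-1) _ Kx Ky; rewrite h scalerDr; apply.
  by rewrite invr_ge0 ler0n invf_le1 ?ler1n.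
rewrite /=; have -> : 2^-1 *: (x + y) - b = 2^-1 *: ((x - b) + (y - b)).
  rewrite addrACA -opprD -mulr2n -[b *+ 2]scaler_nat scalerBr scalerA.
  by rewrite mulVf ?scale1r.
rewrite quadZ.
have := quadDr_le (x - b) (y - b) q_ge0.
by rewrite expr2; lra.
Qed.

Context (T : set 'rV[R]_n) (delta : R) (n0 : (0 < n)%N) (delta1 : 1 <= delta).

Let d0 : 0 < delta. Proof. exact: lt_le_trans delta1. Qed.

Let nR0 : 0 < n%:R :> R. Proof. by rewrite ltr0n. Qed.

Lemma covering_body :
  (forall y, q y <= n%:R / delta ^+ 2 -> T y) ->
  (covering_number K T <= ((12 * delta) ^+ n * (4 / 3) *
    (sup [set f x | x in K] / f (centroid K)))%:E)%E.
Proof.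
move=> qT.
pose c := (4 * delta)^-1.
have d4 : 0 < 4 * delta by rewrite mulr_gt0.
have c0 : 0 < c by rewrite invr_gt0.
have c1 : 0 < 1 + c by rewrite addr_gt0.
have cV : 0 < (1 + c)^-1 by rewrite invr_gt0.
have mK := body_measurable hK.
have mK0 := @measurable_central_part _ _ _ hK s.
(* [S] is [K0 / (4 delta)] and [W] is [(1 + c) K]; the terms [+ 0] match the form of
   [lebesgue_rV_homothety]. *)
pose S := [set y : 'rV[R]_n | K0 (4 * delta *: y + 0)].
pose W := [set y : 'rV[R]_n | K ((1 + c)^-1 *: y + 0)].
have mhom (a : R) (A : set 'rV[R]_n) : measurable A ->
    measurable [set y : 'rV[R]_n | A (a *: y + 0)].
  move=> mA; have := @measurable_affine R n n a%:M 0 measurableT _ mA.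
  by rewrite setTI; under eq_fun do rewrite mul_mx_scalar.
have v0 := central_part_volume_gt0 n0.
have vS : mu S = (vol K0 / (4 * delta) ^+ n)%:E.
  have := lebesgue_rV_homothety 0 d4 mK0; rewrite -/S volume_central_part//.
  move=> h; rewrite mulrC EFinM -h muleA -EFinM mulVf ?mul1e//.
  by rewrite gt_eqF// exprn_gt0.
have vW : mu W = (vol K * (1 + c) ^+ n)%:E.
  have := lebesgue_rV_homothety 0 cV mK; rewrite -/W (body_volumeE hK).
  move=> h; rewrite mulrC EFinM -h muleA -EFinM exprVn mulfV ?mul1e//.
  by rewrite gt_eqF// exprn_gt0.
have [L [cardL covL]] : exists L : {fset 'rV[R]_n},
    ((#|` L|%:R)%:E * mu S <= mu W)%E /\
    forall a, K a -> exists l z z', [/\ l \in L, S z, S z' & a = l + (z - z')].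
  apply: packing_covering.
  - exact: mhom.
  - exact: mhom.
  - by rewrite vS lte_fin divr_gt0// exprn_gt0.
  - by rewrite vW ltry.
  (* [(a + z) / (1 + c)] is a convex combination of [a] and [4 delta z], both in [K], with weights
     [1 / (1 + c)] and [c / (1 + c)]. *)
  move=> a z Ka [Kz _]; rewrite /W/= addr0; have [cK _ _] := hK.
  have := convex_setP cK (t := (1 + c)^-1) _ Ka Kz.
  rewrite addr0 scalerA scalerDr.
  have -> : (1 - (1 + c)^-1) * (4 * delta) = (1 + c)^-1.
    by rewrite /c; field; rewrite !gt_eqF//=; lra.
  by apply; rewrite ltW//= invf_le1// lerDl ltW.
apply: (covering_number_le (L := L)).
  (* [S - S] lies in [4 D / (4 delta) = D / delta]. *)
  move=> a /covL[l [z [z' [lL Sz Sz' ->]]]]; exists l, (z - z'); split=> //.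
  apply: qT; have := central_part_sub Sz Sz'.
  rewrite !addr0 -scalerBr quadZ ler_pdivlMr ?exprn_gt0// exprMn; lra.
move: cardL; rewrite vS vW -EFinM lee_fin mulrA ler_pdivrMr ?exprn_gt0//.
rewrite -[_ * _ * (4 * delta) ^+ n]mulrA -exprMn -ler_pdivlMr// => /le_trans; apply.
have := jensen_exp hK s; have := volume_central_bound n0 (fun _ => id).
rewrite f_body; last exact: centroid_body.
set M := sup _; set E := expR _; set v := vol K0 => h1 h2.
have E0 : 0 < E := expR_gt0 _.
(* Chebyshev bounds [v] from below by the mass, and Jensen bounds [vol K] from above by it, so the
   mass cancels. *)
have vK : vol K / v <= 4 / 3 * (M / E).
  rewrite ler_pdivrMr// mulrAC mulrA ler_pdivlMr//.
  by rewrite -/M -/v in h1; lra.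
rewrite mulrAC mulrC -(mulrA _ (4 / 3)).
apply: ler_pM => //.
- by rewrite exprn_ge0// mulr_ge0// ltW.
- by rewrite divr_ge0// ltW// body_volume_gt0.
(* [(1 + c) * (4 * delta)] is [4 * delta + 1], well below [12 * delta] as [delta >= 1]. *)
apply: lerXn2r; rewrite ?nnegrE ?mulr_ge0 ?(ltW c1) ?(ltW d4) ?(ltW d0)//.
rewrite mulrDl mul1r mulVf ?gt_eqF//.
by move: delta1; lra.
Qed.

(** The power [n] turns the exponents [1 / n] and [1 / (2 n)] into [1] and [1 / 2]; nonnegativity of
    the determinant, read off from a Cholesky factor, makes the latter a square root. *)
Lemma isotropic_constant_exp_on :
  isotropic_constant f ^+ n = sup (range f) / Z * Num.sqrt (\det (covar f)).
Proof.
have [M [M0 _] CE] := posdef_cholesky (covar_posdef hK s).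
have dC : 0 <= \det (covar f) by rewrite CE det_mulmx det_tr mulr_ge0// ltW.
have a0 : 0 <= sup (range f) / Z.
  by rewrite divr_ge0// ltW ?mass_exp_on_gt0//; exact: sup_exp_on_gt0.
rewrite /isotropic_constant exprMn -!powR_mulrn ?powR_ge0// -!powRrM.
rewrite mulVf ?gt_eqF// powRr1// natrM invfM divfK ?gt_eqF//.
by rewrite powR12_sqrt.
Qed.

Lemma covering_by_body :
  (forall y, T y -> q y <= delta ^+ 2 * n%:R) ->
  (covering_number T K <= ((12 * delta ^+ 2) ^+ n *
     vol (scale_set (Num.sqrt n%:R) (@eucl_ball R n)) * (4 / 3) *
     isotropic_constant f ^+ n)%:E)%E.
Proof.
move=> qT; have posC := covar_posdef hK s.
have mK0 := @measurable_central_part _ _ _ hK s.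
have v0 := central_part_volume_gt0 n0.
have vK0 := @volume_central_part _ _ _ hK s.
have d20 : 0 < 2 * delta by rewrite mulr_gt0.
have [x xP] : exists x : 'rV[R]_n, (mu K0 <
    (3 ^+ n)%:E * mu [set z | K0 (x + z)%R /\ K0 (x - z)%R])%E.
  apply: exists_symmetric_core => //.
    by rewrite vK0 lte_fin v0 ltry.
  exact: central_part_midpoint.
set S0 := [set z | _ /\ _] in xP.
have mS0 : measurable S0.
  have m1 := @measurable_affine R n n 1%:M x measurableT _ mK0.
  have m2 := @measurable_affine R n n (-1)%:M x measurableT _ mK0.
  have := measurableI _ _ m1 m2; rewrite !setTI; congr measurable.
  apply/funext => z /=; rewrite mulmx1 mul_mx_scalar scaleN1r addrC.
  by rewrite [- z + x]addrC.
(* Half of the symmetric core: for [z] in [S], both [x + 2 z] and [x - 2 z] lie in [K0]. *)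
pose S := [set y : 'rV[R]_n | S0 (2 *: y + 0)].
have mS : measurable S.
  have := @measurable_affine R n n 2%:M 0 measurableT _ mS0.
  by rewrite setTI; under eq_fun do rewrite mul_mx_scalar.
have vS : ((2 ^+ n)%:E * mu S = mu S0)%E by exact: lebesgue_rV_homothety.
pose W := [set y : 'rV[R]_n | q y <= (2 * delta) ^+ 2 * n%:R].
pose B := scale_set (Num.sqrt n%:R) (@eucl_ball R n).
have BE : B = [set y | quad 1%:M y <= n%:R].
  by rewrite /B eucl_ballE scale_set_quad ?sqrtr_gt0// sqr_sqrtr ?ler0n.
have vB : mu B = (vol B)%:E.
  rewrite /vol fineK// ge0_fin_numE ?measure_ge0//.
  apply: (@bounded_volume _ _ _ (Num.sqrt n%:R)).
    by rewrite BE; exact: measurable_quad_le.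
  rewrite BE => y /=; rewrite /quad mulmx1 -/(dot y y) dotE => yn i.
  rewrite -sqrtr_sqr ler_sqrt ?ler0n//; apply: le_trans yn.
  rewrite (bigD1 i)//= -expr2 lerDl; apply: sumr_ge0 => j _.
  by rewrite -expr2 sqr_ge0.
have vW : mu W = ((2 * delta) ^+ n * Num.sqrt (\det (covar f)) * vol B)%:E.
  by rewrite volume_quad_le// -BE vB -EFinM.
(* The difference of [x + 2 z] and [x - 2 z] is [4 z], so [16 * q z <= 16 * n]: [S] lies in [D]. *)
have core_q z : S z -> q z <= n%:R.
  move=> [/= z1 z2]; have := central_part_sub z1 z2; rewrite addr0.
  have -> : x + 2 *: z - (x - 2 *: z) = 4 *: z.
    by apply/rowP => i; rewrite !mxE; ring.
  rewrite quadZ; lra.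
have [L [cardL covL]] : exists L : {fset 'rV[R]_n},
    ((#|` L|%:R)%:E * mu S <= mu W)%E /\
    forall a, T a -> exists l z z', [/\ l \in L, S z, S z' & a = l + (z - z')].
  apply: packing_covering => //.
  - exact: measurable_quad_le.
  - rewrite lt0e measure_ge0 andbT; apply/eqP => S00.
    by move: xP; rewrite -vS S00 !mule0 vK0 lte_fin ltNge ltW.
  - by rewrite vW ltry.
  (* [T + S] lies in [W], because [2 delta ^ 2 n + 2 n <= (2 delta) ^ 2 n] when [delta >= 1]. *)
  move=> a z /qT qa /core_q qz; rewrite /W/=.
  apply: le_trans (quadDr_le _ _ q_ge0) _; rewrite exprMn.
  have : n%:R <= delta ^+ 2 * n%:R by rewrite ler_peMl// exprn_ege1.
  lra.
(* For [z], [z'] in [S], the point [x + (z - z')] is the midpoint of [x + 2 z] and [x - 2 z'], hence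
   lies in [K0]; moving the centers by [- x] therefore covers [T] by translates of [K]. *)
apply: (covering_number_le (L := [fset l - x | l in L]%fset)).
  move=> a /covL[l [z [z' [lL Sz Sz' ->]]]].
  exists (l - x), (x + (z - z')); split.
  - by apply/imfsetP; exists l.
  - have [+ _] := Sz; have [_ +] := Sz'; rewrite !addr0 => h1 h2.
    have [+ _] := central_part_midpoint h1 h2; congr K.
    by apply/rowP => i; rewrite !mxE; field.
  - by rewrite [RHS]addrA subrK.
have cL : (#|` [fset l - x | l in L]%fset|%:R <= #|` L|%:R :> R).
  by rewrite ler_nat; exact: leq_imfset_card.
apply: (le_trans cL).
(* The factor 6 is 3 from the choice of the center times 2 from halving the core; the [2 * delta] in
   [W] will raise it to [12 * delta]. *)
have : ((#|` L|%:R)%:E * (vol K0)%:E <= (6 ^+ n)%:E * mu W)%E.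
  rewrite -vK0; apply: (@le_trans _ _ ((#|` L|%:R)%:E * ((3 ^+ n)%:E * mu S0))%E).
    by apply: lee_wpmul2l; [rewrite lee_fin|exact: ltW].
  rewrite -vS [((3 ^+ n)%:E * _)%E]muleA -EFinM -exprMn muleCA.
  have -> : 3 * 2 = 6 :> R by ring.
  by apply: lee_wpmul2l => //; rewrite lee_fin exprn_ge0.
rewrite vW -!EFinM lee_fin -ler_pdivlMr// => /le_trans; apply.
rewrite -/B isotropic_constant_exp_on.
have := volume_central_bound n0 (@subsetT _ K).
have := mass_exp_on_gt0 hK s.
set M := sup _; set v := vol K0; set D := Num.sqrt _ => Z0 h1.
have B0 : 0 <= vol B by rewrite fine_ge0// measure_ge0.
have M0 : 0 < M by exact: sup_exp_on_gt0.
have vV : v^-1 <= 4 / 3 * (M / Z).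
  rewrite -[v^-1]mul1r ler_pdivrMr// mulrAC mulrA ler_pdivlMr//.
  by rewrite -/M -/v in h1; lra.
have -> : 6 ^+ n * ((2 * delta) ^+ n * D * vol B) / v =
    ((12 * delta) ^+ n * vol B * D) * v^-1.
  rewrite (_ : 12 * delta = 6 * (2 * delta)); last by ring.
  by rewrite [(6 * _) ^+ n]exprMn; ring.
have -> : (12 * delta ^+ 2) ^+ n * vol B * (4 / 3) * (M / Z * D) =
    ((12 * delta ^+ 2) ^+ n * vol B * D) * (4 / 3 * (M / Z)) by ring.
have D0 : 0 <= D by exact: sqrtr_ge0.
have p0 : 0 <= (12 * delta) ^+ n by rewrite exprn_ge0// mulr_ge0// ltW.
apply: ler_pM => //; rewrite ?invr_ge0 ?mulr_ge0 ?(ltW v0)//.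
(* Only [12 * delta <= 12 * delta ^+ 2] remains, by [delta >= 1]. *)
rewrite ler_wpM2r// ler_wpM2r//.
apply: lerXn2r; rewrite ?nnegrE ?mulr_ge0 ?exprn_ge0 ?(ltW d0)//.
by rewrite ler_pM2l// expr2 ler_peMr// ltW.
Qed.

End coverings.

(** * From inclusions between [T] and ellipsoids to the covering bounds *)

Theorem theorem3p5 (R : realType) (n : nat) (hn : (0 < n)%N)
    (K : set 'rV[R]_n) (hK : convex_body K) (s : 'rV[R]_n)
    (T : set 'rV[R]_n) (hT : convex_body T)
    (delta : R) (hdelta : 1 <= delta)
    (hET : scale_set (Num.sqrt n%:R / delta) (inertia_ellipsoid (exp_on K s))
             `<=` T)
    (hTE : T `<=`
       scale_set (delta * Num.sqrt n%:R) (inertia_ellipsoid (exp_on K s))) :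
  (covering_number K T <=
     ((12 * delta) ^+ n * (4 / 3) *
      (sup [set exp_on K s x | x in K] / exp_on K s (centroid K)))%:E)%E /\
  (covering_number T K <=
     ((12 * delta ^+ 2) ^+ n *
      vol (scale_set (Num.sqrt n%:R) (@eucl_ball R n)) * (4 / 3) *
      isotropic_constant (exp_on K s) ^+ n)%:E)%E.

Proof.
have d0 : 0 < delta := lt_le_trans ltr01 hdelta.
have n0 : 0 < Num.sqrt n%:R :> R by rewrite sqrtr_gt0 ltr0n.
(* Each inclusion becomes a bound on the quadratic form, a multiple [r] of the ellipsoid being its
   sublevel set at [r ^+ 2]: here [n / delta ^ 2] and [delta ^ 2 n]. *)
split.
  apply: covering_body => // y qy; apply: hET.
  rewrite [inertia_ellipsoid _](_ : _ =
    [set x | quad (invmx (covar (exp_on K s))) x <= 1])//.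
  rewrite scale_set_quad ?divr_gt0//=.
  by rewrite exprMn exprVn sqr_sqrtr ?ler0n.
apply: covering_by_body => // y /hTE.
rewrite [inertia_ellipsoid _](_ : _ =
  [set x | quad (invmx (covar (exp_on K s))) x <= 1])//.
rewrite scale_set_quad ?mulr_gt0//=.
by rewrite exprMn sqr_sqrtr ?ler0n.
Qed.
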